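(* For $n\ge 4$ and $k$ with $1\le k\le n-3$, $$\operatorname{Aut}(\mathcal{S}_+^{n,(k)})=\{\alpha L_Q\mid \alpha>0,\ Q\text{ is an } n\times n \text{ orthogonal matrix}\}.$$
   Context: $\mathcal{S}^n$ is the space of $n\times n$ real symmetric matrices and $\mathcal{S}^n_+$ the cone of positive semidefinite ones, realized as the hyperbolicity cone of $P(X)=\det X$ along the identity matrix $I_n$. $\mathcal{S}_+^{n,(k)}$ denotes the $k$-th derivative relaxation of $\mathcal{S}_+^n$: $\mathcal{S}_+^{n,(k)}=\Lambda_+(D_{I_n}^kP,I_n)$, where $D_{I_n}^kP(X)=\frac{d^k}{dt^k}P(X+tI_n)|_{t=0}$ and, for a homogeneous polynomial $g$ on $\mathcal{S}^n$ that is hyperbolic along $I_n$ (i.e. $g(I_n)>0$ and $t\mapsto g(X-tI_n)$ has only real roots for every $X$), $\Lambda_+(g,I_n)=\{X\in\mathcal{S}^n\mid\text{all roots of } t\mapsto g(tI_n-X)\text{ are nonnegative}\}$. Equivalently, for $1\le k\le n-1$, $X\in\mathcal{S}_+^{n,(k)}$ iff the elementary symmetric polynomials of degrees $1,\ldots,n-k$ of the eigenvalues of $X$ are all nonnegative. For $M\in \mathrm{GL}_n(\mathbb{R})$, $L_M:\mathcal{S}^n\to\mathcal{S}^n$ is the linear map $L_M(X)=MXM^T$. For a cone $K\subseteq\mathcal{S}^n$, $\operatorname{Aut}(K)$ is the group of bijective linear maps $L:\mathcal{S}^n\to\mathcal{S}^n$ with $L(K)=K$. *)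

(* Defs.v *)
From HB Require Import structures.
From mathcomp Require Import all_boot all_order all_algebra.
From mathcomp Require Import all_classical all_reals all_analysis.

Set Implicit Arguments.
Unset Strict Implicit.
Unset Printing Implicit Defensive.

Import Order.TTheory GRing.Theory Num.Theory.
Import numFieldNormedType.Exports.

Local Open Scope classical_set_scope.
Local Open Scope ring_scope.

Section HyperbolicityCones.
Variables (R : realType) (V : lmodType R).

(* D_e^k g (x) = d^k/dt^k g(x + t e) at t = 0. *)
Definition dir_derive (k : nat) (e : V) (g : V -> R) : V -> R :=
  fun x => derive1n k (fun t : R => g (x + t *: e)) 0.

(* Only real roots are mentioned: this is meant for g hyperbolic along e, for
   which the polynomial t |-> g (t e - x) is nonzero and has no other roots. *)
Definition hyperbolicity_cone (g : V -> R) (e : V) : set V :=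
  [set x | forall t : R, g (t *: e - x) = 0 -> 0 <= t].

Definition Aut (K : set V) : set (V -> V) :=
  [set L | [/\ linear L, bijective L & L @` K = K]].

End HyperbolicityCones.

Section SymmetricMatrices.
Variables (R : realType) (n : nat).

Record symmx : predArgType :=
  SymMx { symmx_val :> 'M[R]_n; _ : symmx_val \is symmetricmx }.

HB.instance Definition _ := [isSub for symmx_val].
HB.instance Definition _ := [Choice of symmx by <:].

Lemma symmetricmxE (X : 'M[R]_n) : (X \is symmetricmx) = (X == X^T).
Proof. by rewrite is_hermitianmxE expr0 scale1r map_mx_id. Qed.

Fact symmetricmx_submod_closed :
  submod_closed (symmetricmx : {pred 'M[R]_n}).
Proof.
have E X : (X \in (symmetricmx : {pred 'M[R]_n})) = (X == X^T).
  exact: symmetricmxE.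
split=> [|a X Y]; rewrite !E ?trmx0 // => /eqP hX /eqP hY.
by rewrite linearP /= -hX -hY.
Qed.

HB.instance Definition _ :=
  GRing.SubChoice_isSubLmodule.Build R _ _ symmx symmetricmx_submod_closed.

Fact symmx1_subproof : (1%:M : 'M[R]_n) \is symmetricmx.
Proof. by rewrite symmetricmxE trmx1. Qed.

Definition symmx1 : symmx := SymMx symmx1_subproof.

Fact congr_subproof (M : 'M[R]_n) (X : symmx) :
  M *m X *m M^T \is symmetricmx.
Proof.
case: X => X /=; rewrite !symmetricmxE => /eqP hX.
by rewrite !trmx_mul trmxK -hX mulmxA.
Qed.

Definition congr_map (M : 'M[R]_n) : symmx -> symmx :=
  fun X => SymMx (congr_subproof M X).

Definition psd_relaxation (k : nat) : set symmx :=
  hyperbolicity_cone (dir_derive k symmx1 (fun X : symmx => \det X)) symmx1.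

Definition orthogonalmx (Q : 'M[R]_n) : Prop := Q *m Q^T = 1%:M.

End SymmetricMatrices.

Arguments psd_relaxation R n k : clear implicits.

(* Main.v *)
Require Import Defs.
From mathcomp Require Import all_boot all_order all_algebra.
From mathcomp Require Import all_classical all_reals all_analysis.
From mathcomp Require Import complex polyrcf polyorder cauchyreals polyXY perm.
From mathcomp Require Import ring lra zify.

Set Implicit Arguments.
Unset Strict Implicit.
Unset Printing Implicit Defensive.

Import Order.TTheory GRing.Theory Num.Theory.
Import numFieldNormedType.Exports.
Local Open Scope classical_set_scope.
Local Open Scope ring_scope.

(** Write p_X(u) = det(X + u I) and let K be the k-th derivative relaxation.
    A symmetric X lies in K when the roots of the k-th derivative of p_X are
    all <= 0. The polynomial p_X is real-rooted by the spectral theorem, and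
    real-rootedness passes to derivatives by Gauss-Lucas, so membership in K
    says that the coefficients of p_X of degree >= k are nonnegative.

    The main point is that the linear geometry of K remembers the cone of
    positive semidefinite matrices. Call Y touching at X in K when the line
    X + R Y meets K only at X; a linear automorphism of K preserves this
    relation. If X in K is not positive semidefinite, then the k-th derivative
    of p_X has at most a simple root at 0: for a real-rooted polynomial, a
    multiple root of the derivative is a root of the polynomial, and then
    Rolle's theorem would force all roots of p_X to be <= 0. Hence the
    coefficients of degree > k are positive, near X the cone K is cut out by
    the single coefficient of degree k, and the touching directions at X lie in
    the kernel of a nonzero linear form ([touching_hyperplane]). At the
    rank-one matrix E_ii, on the contrary, the touching directions span the
    whole space ([touching_unit_spans]); this is where k <= n - 3 enters. So an
    automorphism L of K sends E_ii to a positive semidefinite matrix, and, since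
    orthogonal congruences are automorphisms of K, both L and its inverse
    preserve the positive semidefinite cone ([Aut_psd]).

    Such a map is a congruence X |-> M X M^T ([psd_preserving_congr]): it sends
    extreme rays to extreme rays, so after a congruence it fixes every E_ii;
    positivity of the images of rank-one matrices then makes it an entrywise
    multiplication by signs e_i e_j.

    Finally, a congruence preserving K is a multiple of an orthogonal one
    ([Aut_congr_orthogonal]). The polar decomposition reduces this to a diagonal
    M. With m = n - k, the diagonal matrices with m entries 1, one entry -1/m
    and k - 1 entries 0 lie on the boundary of K; putting -1/m at a position
    where the diagonal of M is largest, their images stay in K only if the
    entries of M are all equal. *)

(** * Real-rooted polynomials and their derivatives *)

Definition real_split (R : realFieldType) (p : {poly R}) :=
  exists c rs, 0 < c /\ p = c *: \prod_(r <- rs) ('X - r%:P).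

Lemma horner_prod_XsubC (F : fieldType) (rs : seq F) x :
  (\prod_(r <- rs) ('X - r%:P)).[x] = \prod_(r <- rs) (x - r).
Proof. by rewrite horner_prod; apply: eq_bigr => r _; rewrite hornerXsubC. Qed.

Lemma horner_deriv_prod_XsubC (F : fieldType) (rs : seq F) x :
  x \notin rs ->
  (\prod_(r <- rs) ('X - r%:P))^`().[x] =
  \prod_(r <- rs) (x - r) * \sum_(r <- rs) (x - r)^-1.
Proof.
elim: rs => [|a rs IH]; first by rewrite !big_nil derivC horner0 mulr0.
rewrite inE negb_or => /andP[xa xrs]; rewrite !big_cons derivM derivXsubC mul1r.
rewrite hornerD hornerM hornerXsubC IH // horner_prod_XsubC.
have xa0 : x - a != 0 by rewrite subr_eq0.
by rewrite mulrDr mulrAC mulfV // mul1r mulrA.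
Qed.

Lemma horner_deriv2_prod_XsubC (F : fieldType) (rs : seq F) x :
  x \notin rs ->
  (\prod_(r <- rs) ('X - r%:P))^`(2).[x] =
  \prod_(r <- rs) (x - r) *
  ((\sum_(r <- rs) (x - r)^-1) ^+ 2 - \sum_(r <- rs) (x - r)^-1 ^+ 2).
Proof.
rewrite derivnS derivn1.
elim: rs => [|a rs IH].
  by rewrite !big_nil !derivC horner0 expr0n /= subrr mulr0.
rewrite inE negb_or => /andP[xa xrs]; rewrite !big_cons derivM derivXsubC mul1r.
rewrite derivD derivM derivXsubC mul1r.
rewrite !hornerD hornerM hornerXsubC IH // horner_deriv_prod_XsubC //.
have xa0 : x - a != 0 by rewrite subr_eq0.
set p := \prod_(r <- rs) _; set s := \sum_(r <- rs) _; set t := \sum_(r <- rs) _.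
by field.
Qed.

Lemma ImV (R : rcfType) (z : R[i]) :
  complex.Im z^-1 = - (complex.Im z / (complex.Re z ^+ 2 + complex.Im z ^+ 2)).
Proof. by case: z. Qed.

Lemma Im_sum (R : rcfType) (I : Type) (r : seq I) (F : I -> R[i]) :
  complex.Im (\sum_(i <- r) F i) = \sum_(i <- r) complex.Im (F i).
Proof.
elim: r => [|i r IH]; first by rewrite !big_nil.
by rewrite !big_cons -IH; case: (F i) (\sum_(i <- r) F i) => [a b] [c d].
Qed.

(** Away from the roots, the logarithmic derivative at z is the sum of the
    (z - r)^-1, whose imaginary parts all have the sign of - Im z. *)
Lemma gauss_lucas_real (R : rcfType) (rs : seq R) (z : R[i]) :
  rs != [::] ->
  root (map_poly (real_complex R) (\prod_(r <- rs) ('X - r%:P))^`()) z ->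
  complex.Im z = 0.
Proof.
move=> rs0.
rewrite -deriv_map rmorph_prod /= (eq_bigr (fun r : R => 'X - (r%:C%C)%:P)); last first.
  by move=> r _; rewrite rmorphB /= map_polyX map_polyC.
rewrite -(big_map (real_complex R) predT (fun w => 'X - w%:P)).
have [/mapP[r _ ->]//|zrs] := boolP (z \in map (real_complex R) rs).
rewrite rootE horner_deriv_prod_XsubC // mulf_eq0 => /orP[|].
  rewrite prodf_seq_eq0 => /hasP[w ws /=]; rewrite subr_eq0 => /eqP zw.
  by rewrite zw ws in zrs.
move=> /eqP/(congr1 (@complex.Im R)); rewrite big_map Im_sum.
have E r : complex.Im (z - r%:C%C)^-1 =
    - complex.Im z * ((complex.Re z - r) ^+ 2 + complex.Im z ^+ 2)^-1.
  by rewrite ImV mulNr; case: z {zrs} => a b /=; rewrite subr0.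
rewrite (eq_bigr _ (fun r _ => E r)) -mulr_sumr /= => /eqP.
have [//|Iz0] := eqVneq (complex.Im z) 0.
rewrite mulf_eq0 oppr_eq0 (negbTE Iz0) /= gt_eqF //.
have pos r : 0 < ((complex.Re z - r) ^+ 2 + complex.Im z ^+ 2)^-1.
  by rewrite invr_gt0 ltr_wpDl ?sqr_ge0 // lt_neqAle sqr_ge0 eq_sym sqrf_eq0 Iz0.
case: rs rs0 {zrs E} => // a rs _; rewrite big_cons ltr_pwDl //.
by apply: sumr_ge0 => r _; apply: ltW.
Qed.

Lemma size_real_split (R : realFieldType) c (rs : seq R) : 0 < c ->
  size (c *: \prod_(r <- rs) ('X - r%:P)) = (size rs).+1.
Proof. by move=> c0; rewrite size_scale ?gt_eqF // size_prod_XsubC. Qed.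

(** The derivative splits over R[i], and its roots there are real. *)
Lemma real_split_deriv (R : rcfType) (p : {poly R}) :
  real_split p -> (1 < size p)%N -> real_split p^`().
Proof.
move=> [c [rs [c0 ->]]]; rewrite size_real_split // => rs1.
have rs0 : rs != [::] by case: rs rs1.
rewrite derivZ; set q := \prod_(r <- rs) _.
have [zs Ezs] := closed_field_poly_normal (map_poly (real_complex R) q^`()).
have mq : q \is monic by apply: monic_prod_XsubC.
have sq : size q = (size rs).+1 by rewrite size_prod_XsubC.
have lq0 : 0 < lead_coef q^`().
  rewrite lead_coefE size_deriv sq coef_deriv /= prednK //.
  by move: (monicP mq); rewrite lead_coefE sq /= => ->; rewrite pmulrn_lgt0 ?ltr01.
rewrite lead_coef_map in Ezs.
exists (c * lead_coef q^`()), (map (@complex.Re R) zs); split; first exact: mulr_gt0.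
rewrite -scalerA; congr (_ *: _).
apply: (@map_poly_inj _ _ (real_complex R)) => /=.
rewrite Ezs map_polyZ; congr (_ *: _).
rewrite big_map rmorph_prod /=; apply: eq_big_seq => z zzs.
rewrite rmorphB /= map_polyX map_polyC /=.
suff <- : z = (complex.Re z)%:C%C by [].
have : root (map_poly (real_complex R) q^`()) z.
  by rewrite Ezs rootZ ?root_prod_XsubC // fmorph_eq0 gt_eqF.
by move/(gauss_lucas_real rs0); case: (z) => a b /= ->.
Qed.

Lemma real_split_derivn (R : rcfType) (p : {poly R}) k :
  real_split p -> (k < size p)%N -> real_split p^`(k).
Proof.
move=> sp; elim: k => [|k IH] kp //; rewrite derivnS.
apply: real_split_deriv; first exact: IH (ltnW kp).
by rewrite size_derivn ltn_subRL addn1.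
Qed.

Lemma coef_prod_XsubC_ge0 (R : realFieldType) (rs : seq R) j :
  all (fun r => r <= 0) rs -> 0 <= (\prod_(r <- rs) ('X - r%:P))`_j.
Proof.
elim: rs j => [|a rs IH] j; first by rewrite big_nil coef1 ler0n.
move=> /= /andP[a0 rs0]; rewrite big_cons mulrBl coefB coefXM coefCM.
rewrite -mulNr addr_ge0 ?mulr_ge0 ?oppr_ge0 ?IH //.
by case: eqP => // _; apply: IH.
Qed.

Lemma coef_prod_XsubC_gt0 (R : realFieldType) (rs : seq R) j :
  all (fun r => r < 0) rs -> (j <= size rs)%N ->
  0 < (\prod_(r <- rs) ('X - r%:P))`_j.
Proof.
elim: rs j => [|a rs IH] j; first by rewrite big_nil coef1 leqn0 => _ /eqP->.
move=> /= /andP[a0 rs0] jrs; rewrite big_cons mulrBl coefB coefXM coefCM.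
have rs0' : all (fun r => r <= 0) rs.
  by apply: sub_all rs0 => r; apply: ltW.
rewrite -mulNr; case: j jrs => [|j] jrs /=.
  by rewrite add0r mulr_gt0 ?oppr_gt0 ?IH.
by rewrite ltr_pwDl ?IH // mulr_ge0 ?oppr_ge0 ?(ltW a0) ?coef_prod_XsubC_ge0.
Qed.

(** If 0 is a root, it is a simple one; dividing it out shifts the
    coefficients and leaves only negative roots. *)
Lemma coef_prod_XsubC_gt0_simple (R : realFieldType) (rs : seq R) j :
  let p := \prod_(r <- rs) ('X - r%:P) in
  all (fun r => r <= 0) rs -> (p`_0 != 0) || (p`_1 != 0) ->
  (0 < j <= size rs)%N -> 0 < p`_j.
Proof.
move=> /=; have [z0|z0] := boolP (0 \in rs); last first.
  move=> rs0 _ /andP[_ jrs]; apply: coef_prod_XsubC_gt0 => //.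
  apply/allP => r rrs; rewrite lt_neqAle (allP rs0) // andbT.
  by apply: contraNneq z0 => <-.
rewrite (perm_big _ (perm_to_rem z0)) /= big_cons subr0 !coefXM /= eqxx /=.
rewrite (perm_all _ (perm_to_rem z0)) (perm_size (perm_to_rem z0)) /=.
move=> /andP[_ rs0] p0 /andP[j0 jrs]; rewrite gtn_eqF //.
apply: coef_prod_XsubC_gt0; last by rewrite -ltnS prednK.
apply/allP => r rrs; rewrite lt_neqAle (allP rs0) // andbT.
apply: contraNneq p0 => r0; rewrite r0 in rrs.
by rewrite -horner_coef0 -rootE root_prod_XsubC.
Qed.

Section RealSplit.
Variables (R : rcfType) (p : {poly R}).
Hypothesis sp : real_split p.

Lemma real_split_coef_ge0 j :
  (forall x, root p x -> x <= 0) -> 0 <= p`_j.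
Proof.
case: sp => c [rs [c0 ->]] r0; rewrite coefZ mulr_ge0 ?(ltW c0) //.
apply: coef_prod_XsubC_ge0; apply/allP => r rrs; apply: r0.
by rewrite rootZ ?root_prod_XsubC // gt_eqF.
Qed.

Lemma real_split_coef_gt0 j :
  (forall x, root p x -> x <= 0) -> (p`_0 != 0) || (p`_1 != 0) ->
  (0 < j < size p)%N -> 0 < p`_j.
Proof.
case: sp => c [rs [c0 ->]] r0; rewrite !coefZ !mulf_eq0 gt_eqF //= => p0.
rewrite size_real_split // ltnS => js; rewrite mulr_gt0 //.
apply: coef_prod_XsubC_gt0_simple => //; apply/allP => r rrs; apply: r0.
by rewrite rootZ ?root_prod_XsubC // gt_eqF.
Qed.

(** Where a nonconstant p does not vanish, p'^2 - p p'' is p^2 times the sum of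
    the (x - r)^-2, hence positive; so p' and p'' cannot both vanish there. *)
Lemma real_split_double_root_deriv :
  (1 < size p)%N -> p^`().[0] = 0 -> p^`(2).[0] = 0 -> p.[0] = 0.
Proof.
case: sp => c [rs [c0 ->]]; rewrite size_real_split // ltnS => rs0.
have [z0|z0] := boolP (0 \in rs).
  by move=> *; apply/eqP; rewrite -rootE rootZ ?root_prod_XsubC ?gt_eqF.
rewrite derivZ (derivnZ 2) !hornerZ horner_deriv2_prod_XsubC //.
rewrite horner_deriv_prod_XsubC // => /eqP.
have pr0 : \prod_(r <- rs) (0 - r) != 0.
  rewrite prodf_seq_neq0; apply/allP => r rrs /=; rewrite sub0r oppr_eq0.
  by apply: contraNneq z0 => <-.
rewrite !mulf_eq0 (negbTE pr0) gt_eqF //= => s0.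
move: s0 => /eqP ->; rewrite expr0n /= sub0r => /eqP.
rewrite !mulf_eq0 (negbTE pr0) gt_eqF //= oppr_eq0 psumr_eq0; last first.
  by move=> r _; rewrite sqr_ge0.
case: rs rs0 z0 {pr0} => // a rs _; rewrite inE negb_or => /andP[a0 _] /=.
by rewrite sqrf_eq0 invr_eq0 sub0r oppr_eq0 eq_sym (negbTE a0).
Qed.

(** As p(0) = 0, a positive root of p would give p' a positive root by
    Rolle's theorem. *)
Lemma real_split_roots_le0_deriv :
  (1 < size p)%N -> (forall x, root p^`() x -> x <= 0) ->
  p^`().[0] = 0 -> p^`(2).[0] = 0 -> forall x, root p x -> x <= 0.
Proof.
move=> p1 r0 d1 d2 x /rootP px; rewrite leNgt; apply/negP => x0.
have p0 := real_split_double_root_deriv p1 d1 d2.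
have [y] := poly_rolle x0 (etrans p0 (esym px)).
rewrite in_itv /= => /andP[y0 _] /rootP/r0; by rewrite leNgt y0.
Qed.

End RealSplit.

(** This is what makes the boundary of the relaxation smooth outside the
    positive semidefinite cone: a multiple root at 0 of the k-th derivative
    propagates down to the polynomial itself. *)
Lemma real_split_roots_le0_derivn (R : rcfType) (p : {poly R}) k :
  real_split p -> (k < size p)%N -> (forall x, root p^`(k) x -> x <= 0) ->
  p^`(k).[0] = 0 -> p^`(k.+1).[0] = 0 -> forall x, root p x -> x <= 0.
Proof.
move=> sp; elim: k => [|k IH] kp // r0 d1 d2.
have sk := real_split_derivn sp (ltnW kp).
have sz : (1 < size p^`(k))%N by rewrite size_derivn ltn_subRL addn1.
rewrite derivnS in r0 d1; rewrite derivnS in d2.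
have d2' : p^`(k)^`(2).[0] = 0 by rewrite !derivnS derivn0; rewrite derivnS in d2.
apply: IH; first exact: ltnW.
- exact: real_split_roots_le0_deriv.
- exact: real_split_double_root_deriv.
- by rewrite derivnS.
Qed.

Lemma coef_ge0_root_le0 (R : realFieldType) (p : {poly R}) x :
  (forall j, 0 <= p`_j) -> p != 0 -> root p x -> x <= 0.
Proof.
move=> pj p0 /rootP px; rewrite leNgt; apply/negP => x0.
have: 0 < p.[x]; last by rewrite px ltxx.
have lp : 0 < lead_coef p by rewrite lt_neqAle eq_sym lead_coef_eq0 p0 lead_coefE pj.
rewrite horner_coef -(prednK (n := size p)) ?size_poly_gt0 // big_ord_recr /=.
rewrite ltr_wpDl //; last by rewrite mulr_gt0 ?exprn_gt0.
by apply: sumr_ge0 => i _; rewrite mulr_ge0 ?exprn_ge0 // ltW.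
Qed.

(** * The spectral theorem for real symmetric matrices *)

Section Dot.
Variables (R : realFieldType) (n : nat).
Implicit Types u v : 'rV[R]_n.

Lemma mulmx_trE u v : (u *m v^T) 0 0 = \sum_i u 0 i * v 0 i.
Proof. by rewrite mxE; apply: eq_bigr => i _; rewrite mxE. Qed.

Lemma mulmx_tr_ge0 u : 0 <= (u *m u^T) 0 0.
Proof. by rewrite mulmx_trE; apply: sumr_ge0 => i _; rewrite -expr2 sqr_ge0. Qed.

Lemma mulmx_tr_eq0 u : ((u *m u^T) 0 0 == 0) = (u == 0).
Proof.
apply/eqP/eqP => [|->]; last by rewrite mul0mx mxE.
rewrite mulmx_trE => /eqP; rewrite psumr_eq0 => [/allP h|i _]; last first.
  by rewrite -expr2 sqr_ge0.
apply/rowP => i; rewrite mxE; apply/eqP; rewrite -sqrf_eq0 expr2.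
exact: (h i (mem_index_enum i)).
Qed.

Lemma mulmx_tr_gt0 u : u != 0 -> 0 < (u *m u^T) 0 0.
Proof. by move=> u0; rewrite lt_neqAle mulmx_tr_ge0 eq_sym mulmx_tr_eq0 u0. Qed.

(** The reflection in the hyperplane orthogonal to u - e_i exchanges the unit
    vectors e_i and u. *)
Lemma householder (i : 'I_n) u : u *m u^T = 1%:M ->
  exists2 H : 'M[R]_n, H *m H^T = 1%:M & delta_mx 0 i *m H = u.
Proof.
move=> u1; pose e : 'rV[R]_n := delta_mx 0 i.
have [->|ue] := eqVneq u e.
  by exists 1%:M; rewrite ?trmx1 mulmx1.
pose w := u - e; pose c := (w *m w^T) 0 0.
have c0 : c != 0 by rewrite mulmx_tr_eq0 subr_eq0.
have wwT : w *m w^T = c%:M by rewrite [LHS]mx11_scalar.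
have e1 : e *m e^T = 1%:M.
  by rewrite trmx_delta mul_delta_mx [LHS]mx11_scalar mxE !eqxx.
have ewT : e *m w^T = (- (c / 2))%:M.
  have ue' : e *m u^T = u *m e^T.
    by rewrite [RHS]mx11_scalar -[in RHS](trmxK u) -trmx_mul mxE -mx11_scalar.
  have cE : c = 2 - 2 * (u *m e^T) 0 0.
    rewrite /c /w linearB /= mulmxBl !mulmxBr u1 e1 ue'.
    by move: (u *m e^T) => M; rewrite !mxE eqxx mulr1n; ring.
  rewrite [LHS]mx11_scalar cE /w linearB /= mulmxBr e1 ue'; congr _%:M.
  by move: (u *m e^T) => M; rewrite !mxE eqxx mulr1n; field.
exists (1%:M - (2 / c) *: (w^T *m w)).
  have wwN : w^T *m w *m (w^T *m w) = c *: (w^T *m w).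
    by rewrite -mulmxA (mulmxA w) wwT mul_scalar_mx scalemxAr.
  have -> : (1%:M - (2 / c) *: (w^T *m w))^T = 1%:M - (2 / c) *: (w^T *m w).
    by rewrite linearB linearZ /= trmx1 trmx_mul trmxK.
  rewrite mulmxBr mulmx1 mulmxBl mul1mx -scalemxAr -scalemxAl wwN.
  by move: (w^T *m w) => W; apply/matrixP => a b; rewrite !mxE; field.
rewrite mulmxBr mulmx1 -scalemxAr mulmxA ewT mul_scalar_mx scalerA.
have -> : 2 / c * - (c / 2) = -1 by field.
by rewrite scaleN1r opprK addrC subrK.
Qed.

End Dot.

Section Spectral.
Variable R : rcfType.

(** If v A = z v over R[i], then evaluating v A v^* in two ways gives
    z |v|^2 = z^* |v|^2. *)
Lemma symmetric_eigenvalue n (A : 'M[R]_n.+1) : A^T = A ->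
  exists a, eigenvalue A a.
Proof.
move=> AT; pose AC := map_mx (real_complex R) A.
have : size (char_poly AC) != 1%N by rewrite size_char_poly.
case/closed_rootP => z rz; exists (complex.Re z).
move: (rz); rewrite -eigenvalue_root_char => /eigenvalueP[v vA v0].
pose vc := map_mx (@conjc R) v.
have ACc : map_mx (@conjc R) AC = AC.
  by apply/matrixP => i j; rewrite !mxE conjc_real.
have ACT : AC^T = AC by rewrite /AC map_trmx AT.
have vcA : AC *m vc^T = z^*%C *: vc^T.
  rewrite -{1}ACT -trmx_mul -{1}ACc -map_mxM vA.
  by apply/matrixP => i j; rewrite !mxE rmorphM.
have : v *m AC *m vc^T = v *m (AC *m vc^T) by rewrite mulmxA.
rewrite vA vcA -scalemxAl -scalemxAr => /eqP; rewrite -subr_eq0 -scalerBl.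
rewrite scaler_eq0 => /orP[|vv0]; last first.
  case/negP: v0; apply/eqP/rowP => i; move/eqP: vv0 => /matrixP/(_ 0 0).
  rewrite !mxE => /eqP; rewrite psumr_eq0 => [/allP h|j _]; last first.
    by rewrite !mxE mulcJ_ge0.
  move: (h i (mem_index_enum i)); rewrite !mxE /= mulf_eq0 conjc_eq0 orbb.
  by move/eqP.
rewrite subr_eq0 => /eqP zz.
have zE : z = (complex.Re z)%:C%C.
  by case: (z) zz => a b [] bb; congr Complex; lra.
rewrite eigenvalue_root_char -(fmorph_root (real_complex R)) /=.
rewrite -[X in root _ X]/(_%:C%C) -zE.
by rewrite map_char_poly.
Qed.

(** An orthogonal matrix whose first row is a unit eigenvector splits off a
    1 x 1 block; the rest is by induction. *)
Lemma spectral_theorem n (A : 'M[R]_n) : A^T = A ->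
  exists (Q : 'M[R]_n) (d : 'rV[R]_n),
    Q *m Q^T = 1%:M /\ A = Q^T *m diag_mx d *m Q.
Proof.
elim: n A => [|n IH] A AT.
  exists 1%:M, 0; split; first by rewrite trmx1 mulmx1.
  by apply/matrixP => -[].
have [a /eigenvalueP[v vA v0]] := symmetric_eigenvalue AT.
have := mulmx_tr_gt0 v0; have := mx11_scalar (v *m v^T).
move: ((v *m v^T) 0 0) => c vvT c0.
pose u := (Num.sqrt c)^-1 *: v.
have u1 : u *m u^T = 1%:M.
  rewrite /u linearZ /= -scalemxAr -scalemxAl scalerA vvT.
  by rewrite -invfM -expr2 sqr_sqrtr ?(ltW c0) // scale_scalar_mx mulVf ?gt_eqF.
have uA : u *m A = a *: u by rewrite -scalemxAl vA scalerA mulrC -scalerA.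
have [H H1 Hu] := householder 0 u1.
have H1' : H^T *m H = 1%:M by apply: mulmx1C.
pose B : 'M[R]_(1 + n) := H *m A *m H^T.
have BT : B^T = B by rewrite /B !trmx_mul trmxK AT mulmxA.
have B0 : delta_mx 0 0 *m B = a *: delta_mx 0 0 :> 'rV_(1 + n).
  by rewrite /B !mulmxA Hu uA -scalemxAl -Hu -mulmxA H1 mulmx1.
have B0j (i j : 'I_(1 + n)) : val i = 0%N -> B i j = a * (val j == 0%N)%:R.
  move=> i0; have -> : i = 0 by apply: val_inj.
  by move: B0; rewrite -rowE => /rowP/(_ j); rewrite !mxE.
have BE : B = block_mx a%:M 0 0 (drsubmx B).
  rewrite -[LHS]submxK; congr block_mx; apply/matrixP => i j.
  - by rewrite !ord1 [LHS]mxE mxE B0j // mulr1 mxE.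
  - by rewrite !ord1 [LHS]mxE mxE B0j // mulr0 mxE.
  - by rewrite !ord1 [LHS]mxE mxE -BT mxE B0j // mulr0 mxE.
have [|Q [d [Q1 Qd]]] := IH (drsubmx B); first by rewrite trmx_drsub BT.
pose K : 'M[R]_(1 + n) := block_mx 1%:M 0 0 Q.
have KT : K^T = block_mx 1%:M 0 0 Q^T by rewrite tr_block_mx trmx1 !trmx0.
have K1 : K *m K^T = 1%:M.
  rewrite KT mulmx_block !mul0mx !mulmx0 !mul1mx !addr0 add0r Q1.
  by rewrite -scalar_mx_block.
have BK : B = K^T *m diag_mx (row_mx a%:M d) *m K.
  rewrite KT diag_mx_row !mulmx_block.
  rewrite !mul0mx !mulmx0 !mul1mx !mulmx1 !addr0 !add0r -Qd {1}BE.
  congr block_mx; last by rewrite [RHS]mul0mx.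
  by apply/matrixP => i j; rewrite !ord1 !mxE eqxx.
have K1' : (K : 'M[R]_n.+1) *m (K : 'M[R]_n.+1)^T = 1%:M := K1.
exists (K *m H), (row_mx a%:M d); split.
  by rewrite trmx_mul mulmxA -(mulmxA K) H1 mulmx1 K1'.
have -> : A = H^T *m B *m H.
  by rewrite /B !mulmxA H1' mul1mx -mulmxA H1' mulmx1.
by rewrite BK trmx_mul !mulmxA.
Qed.

End Spectral.

Lemma char_poly_orthogonal (R : comNzRingType) n (A Q : 'M[R]_n) :
  Q *m Q^T = 1%:M -> char_poly (Q^T *m A *m Q) = char_poly A.
Proof.
move=> Q1; have Q1' : Q^T *m Q = 1%:M by apply: mulmx1C.
rewrite /char_poly /char_poly_mx !map_mxM /=.
pose P := map_mx polyC Q.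
have P1 : P^T *m P = 1%:M by rewrite /P map_trmx -map_mxM Q1' map_mx1.
have -> : 'X%:M - map_mx polyC Q^T *m map_mx polyC A *m map_mx polyC Q
  = P^T *m ('X%:M - map_mx polyC A) *m P.
  rewrite mulmxBr mulmxBl mul_mx_scalar -scalemxAl P1 scalemx1.
  by rewrite /P map_trmx.
by rewrite !det_mulmx mulrAC -det_mulmx P1 det1 mul1r.
Qed.

Lemma char_poly_diag (R : comNzRingType) n (d : 'rV[R]_n) :
  char_poly (diag_mx d) = \prod_i ('X - (d 0 i)%:P).
Proof.
rewrite char_poly_trig ?diag_mx_is_trig //.
by apply: eq_bigr => i _; rewrite mxE eqxx.
Qed.

(** * The polynomial det(A + u I) and its first-order variation *)

Lemma derivn_comp_affine (R : comNzRingType) (p : {poly R}) a b k :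
  (p \Po (a *: 'X + b%:P))^`(k) = a ^+ k *: (p^`(k) \Po (a *: 'X + b%:P)).
Proof.
elim: k => [|k IH]; first by rewrite !derivn0 scale1r.
rewrite derivnS IH derivZ deriv_comp derivD derivC addr0 derivZ derivX -derivnS.
by rewrite -scalerAr mulr1 scalerA exprSr.
Qed.

Lemma derive1n_horner (R : realType) (p : {poly R}) k :
  derive1n k (horner p) = horner p^`(k).
Proof.
elim: k => [|k IH]; first by rewrite derivn0.
by rewrite derive1nS IH -derive.derivE derivnS.
Qed.

Section ShiftPoly.
Variables (R : comNzRingType) (n : nat).
Implicit Types A : 'M[R]_n.

(** This is det(A + u I) as a polynomial in u. *)
Definition shift_poly A : {poly R} := char_poly (- A).

Lemma horner_shift_poly A t : (shift_poly A).[t] = \det (A + t%:M).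
Proof.
rewrite -[LHS]horner_evalE -det_map_mx /char_poly_mx; congr (\det _).
apply/matrixP => i j; rewrite !mxE /= /horner_eval hornerD hornerN hornerC opprK.
by rewrite hornerMn hornerX addrC.
Qed.

Lemma shift_polyD A s : shift_poly (A + s%:M) = shift_poly A \Po ('X + s%:P).
Proof.
rewrite /shift_poly /char_poly.
rewrite -[_ \Po _]/(comp_poly _ _) -det_map_mx; congr (\det _).
apply/matrixP => i j; rewrite !mxE /= rmorphB /= !rmorphN !rmorphMn /=.
rewrite comp_polyX comp_polyC polyCD polyCMn opprD mulrnDl.
by rewrite opprD !opprK [in RHS]addrAC addrA.
Qed.

End ShiftPoly.

Section Coef1.
Variables (S : comNzRingType).

(** The coefficient of degree 1 is a first-order variation, hence linear in
    the direction (b_i). *)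
Lemma coef1_prod_linear (I : Type) (r : seq I) (a b b' : I -> S) t :
  (\prod_(i <- r) ((a i)%:P + 'X * (t * b i + b' i)%:P))`_1 =
  t * (\prod_(i <- r) ((a i)%:P + 'X * (b i)%:P))`_1 +
  (\prod_(i <- r) ((a i)%:P + 'X * (b' i)%:P))`_1.
Proof.
have c0 (c : I -> S) (s : seq I) :
    (\prod_(i <- s) ((a i)%:P + 'X * (c i)%:P))`_0 = \prod_(i <- s) a i.
  rewrite -horner_coef0 horner_prod; apply: eq_bigr => i _.
  by rewrite hornerD hornerM hornerX !hornerC mul0r addr0.
elim: r => [|i r IH]; first by rewrite !big_nil coef1 mulr0 addr0.
have c1 c : (\prod_(i <- i :: r) ((a i)%:P + 'X * (c i)%:P))`_1 =
    a i * (\prod_(i <- r) ((a i)%:P + 'X * (c i)%:P))`_1 +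
    c i * \prod_(i <- r) a i.
  rewrite big_cons mulrDl coefD coefCM -mulrA coefXM /=.
  by rewrite coefCM c0.
rewrite !c1 IH; ring.
Qed.

Lemma coef1_det_linear n (M N N' : 'M[S]_n) t :
  (\det (map_mx polyC M + 'X *: map_mx polyC (t *: N + N')))`_1 =
  t * (\det (map_mx polyC M + 'X *: map_mx polyC N))`_1 +
  (\det (map_mx polyC M + 'X *: map_mx polyC N'))`_1.
Proof.
rewrite /determinant !coef_sum mulr_sumr -big_split /=; apply: eq_bigr => s _.
have sg (e : nat) (q : {poly S}) : ((-1) ^+ e * q)`_1 = (-1) ^+ e * q`_1.
  by rewrite -polyC1 -polyCN -polyC_exp coefCM.
rewrite !sg mulrCA -mulrDr; congr (_ * _).
have E (L : 'M[S]_n) : \prod_i (map_mx polyC M + 'X *: map_mx polyC L) i (s i)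
    = \prod_i ((M i (s i))%:P + 'X * (L i (s i))%:P).
  by apply: eq_bigr => i _; rewrite !mxE.
rewrite !E -coef1_prod_linear; congr (polyseq _)`_1.
by apply: eq_bigr => i _; rewrite !mxE.
Qed.

End Coef1.

Section PencilPoly.
Variables (S : comNzRingType).

(** This is det(A + u I + s B); the outer variable is s and the inner one u. *)
Definition pencil_poly n (A B : 'M[S]_n) : {poly {poly S}} :=
  \det (map_mx polyC (char_poly_mx (- A)) + 'X *: map_mx polyC (map_mx polyC B)).

Lemma horner_pencil_poly n (A B : 'M[S]_n) s :
  (pencil_poly A B).[s%:P] = shift_poly (A + s *: B).
Proof.
rewrite -[LHS]horner_evalE -det_map_mx; congr (\det _).
apply/matrixP => i j; rewrite !mxE /= /horner_eval !hornerE.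
rewrite !polyCN !polyCD polyCM. ring.
Qed.

(** Exchanging the two variables turns each coefficient in u of
    det(A + u I + s B) into a polynomial in s. *)
Lemma horner_coef_pencil_poly n (A B : 'M[S]_n) (s : S) (j : nat) :
  ((swapXY (pencil_poly A B))`_j).[s] = (shift_poly (A + s *: B))`_j.
Proof.
rewrite -horner_pencil_poly -[in RHS](swapXYK (pencil_poly A B)) horner_swapXY.
by rewrite coef_map.
Qed.

Lemma coef1_pencil_poly_linear n (A B B' : 'M[S]_n) t j :
  (swapXY (pencil_poly A (t *: B + B')))`_j`_1 =
  t * (swapXY (pencil_poly A B))`_j`_1 + (swapXY (pencil_poly A B'))`_j`_1.
Proof.
have E : map_mx polyC (t *: B + B') =
    t%:P *: map_mx polyC B + map_mx polyC B'.
  by apply/matrixP => i i'; rewrite !mxE polyCD polyCM.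
have : (pencil_poly A (t *: B + B'))`_1 =
    t%:P * (pencil_poly A B)`_1 + (pencil_poly A B')`_1.
  by rewrite {1}/pencil_poly E; apply: coef1_det_linear.
move: (pencil_poly A (t *: B + B')) (pencil_poly A B) (pencil_poly A B').
by move=> p q r pqr; rewrite !coef_swapXY pqr coefD coefCM.
Qed.

End PencilPoly.

(** * Derivative relaxations through coefficients *)

Section Symmx.
Variables (R : realType) (n : nat).
Implicit Types (X Y : symmx R n) (A : 'M[R]_n).

Definition psd A := forall v : 'rV[R]_n, 0 <= (v *m A *m v^T) 0 0.

Lemma symmx_tr X : (X : 'M[R]_n)^T = X.
Proof. by case: X => A /=; rewrite symmetricmxE => /eqP <-. Qed.

Lemma symmxP (A : 'M[R]_n) : A^T = A -> A \is symmetricmx.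
Proof. by move=> AT; rewrite symmetricmxE AT. Qed.

Lemma symmx_inj X Y : X = Y :> 'M[R]_n -> X = Y.
Proof. exact: val_inj. Qed.

Lemma symmxD X Y : (X + Y : symmx R n) = X + Y :> 'M[R]_n.
Proof. by []. Qed.

Lemma symmxZ a X : (a *: X : symmx R n) = a *: (X : 'M[R]_n) :> 'M[R]_n.
Proof. by []. Qed.

Lemma symmx_lineE X Y s i j :
  (X + s *: Y : symmx R n) i j = X i j + s * Y i j.
Proof.
by rewrite -[symmx_val _]/((X : 'M[R]_n) + s *: (Y : 'M[R]_n)) mxE [in LHS]mxE.
Qed.

Lemma symmx_sum (I : Type) (r : seq I) (P : pred I) (F : I -> symmx R n) :
  (\sum_(i <- r | P i) F i : symmx R n) =
  \sum_(i <- r | P i) (F i : 'M[R]_n) :> 'M[R]_n.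
Proof. exact: (big_morph (@symmx_val R n) symmxD (erefl _)). Qed.

Lemma shift_poly_diag (d : 'rV[R]_n) :
  shift_poly (diag_mx d) = \prod_i ('X + (d 0 i)%:P).
Proof.
rewrite /shift_poly -raddfN char_poly_diag; apply: eq_bigr => i _.
by rewrite mxE polyCN opprK.
Qed.

Lemma shift_poly_orthogonal (Q A : 'M[R]_n) : Q *m Q^T = 1%:M ->
  shift_poly (Q^T *m A *m Q) = shift_poly A.
Proof.
by move=> Q1; rewrite /shift_poly -mulNmx -mulmxN char_poly_orthogonal.
Qed.

(** The roots are listed as a sequence, the form in which real-rooted
    polynomials are treated above. *)
Lemma shift_poly_spectral (Q : 'M[R]_n) (d : 'rV[R]_n) : Q *m Q^T = 1%:M ->
  shift_poly (Q^T *m diag_mx d *m Q) =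
  \prod_(r <- [seq - d 0 i | i : 'I_n]) ('X - r%:P).
Proof.
move=> Q1; rewrite shift_poly_orthogonal // shift_poly_diag big_image /=.
by apply: eq_bigr => i _; rewrite polyCN opprK.
Qed.

Lemma size_shift_poly A : size (shift_poly A) = n.+1.
Proof. exact: size_char_poly. Qed.

Lemma real_split_shift_poly X : real_split (shift_poly X).
Proof.
have [Q [d [Q1 ->]]] := spectral_theorem (symmx_tr X).
by exists 1, [seq - d 0 i | i : 'I_n]; rewrite scale1r shift_poly_spectral.
Qed.

Lemma psd_spectral (Q : 'M[R]_n) (d : 'rV[R]_n) : (forall i, 0 <= d 0 i) ->
  psd (Q^T *m diag_mx d *m Q).
Proof.
move=> d0 v; rewrite !mulmxA -mulmxA -[Q *m _]trmxK trmx_mul trmxK.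
rewrite -[v *m _ *m _]/(_ *m diag_mx d) mul_mx_diag mulmx_trE.
by apply: sumr_ge0 => i _; rewrite mxE mulrAC mulr_ge0 // -expr2 sqr_ge0.
Qed.

Lemma psd_diag_ge0 (Q : 'M[R]_n) (d : 'rV[R]_n) i : Q *m Q^T = 1%:M ->
  psd (Q^T *m diag_mx d *m Q) -> 0 <= d 0 i.
Proof.
move=> Q1 /(_ (delta_mx 0 i *m Q)).
rewrite trmx_mul !mulmxA -(mulmxA _ Q) Q1 mulmx1 -(mulmxA _ Q) Q1 mulmx1.
rewrite -rowE row_diag_mx -scalemxAl trmx_delta mul_delta_mx !mxE !eqxx.
by rewrite mulr1.
Qed.

Lemma psd_root_shift_poly X :
  (forall x, root (shift_poly X) x -> x <= 0) -> psd X.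
Proof.
have [Q [d [Q1 ->]]] := spectral_theorem (symmx_tr X).
rewrite shift_poly_spectral // => h; apply: psd_spectral => i.
rewrite -oppr_le0; apply: h; rewrite root_prod_XsubC.
by apply/mapP; exists i; rewrite ?mem_enum.
Qed.

(** The polynomial u |-> det(u I - X) is p_X(- u) up to sign, so
    nonnegative roots become nonpositive ones. *)
Lemma psd_relaxationP k X :
  psd_relaxation R n k X <->
  (forall t, root (shift_poly X)^`(k) t -> t <= 0).
Proof.
have E (t : R) : dir_derive k (symmx1 R n) (fun X : symmx R n => \det X)
    (t *: symmx1 R n - X) = (-1) ^+ n * (-1) ^+ k * (shift_poly X)^`(k).[- t].
  pose q := (-1) ^+ n *: (shift_poly X \Po ((-1) *: 'X + (- t)%:P)).
  rewrite /dir_derive (_ : (fun s => _) = horner q).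
    rewrite derive1n_horner derivnZ derivn_comp_affine !hornerZ horner_comp.
    by rewrite hornerD hornerZ hornerX hornerC mulr0 add0r mulrA.
  apply/funext => s; rewrite /q hornerZ horner_comp horner_shift_poly -detZ.
  rewrite hornerD hornerZ hornerX hornerC; congr (\det _).
  rewrite -[symmx_val (_ + _)]/(t *: 1%:M - (X : 'M[R]_n) + s *: 1%:M).
  by apply/matrixP => i j; rewrite !mxE; case: (i == j); rewrite ?mulr1n ?mulr0n; ring.
rewrite /psd_relaxation /hyperbolicity_cone /=; split=> h t.
  move=> /rootP rt; rewrite -oppr_ge0; apply: h; rewrite E opprK rt.
  by rewrite mulr0.
rewrite E => /eqP; rewrite !mulf_eq0 !signr_eq0 /= => rt.
by rewrite -oppr_le0; apply: h.
Qed.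

Lemma psd_relaxation_coef_ge0 k X j : (k <= n)%N -> psd_relaxation R n k X ->
  (k <= j)%N -> 0 <= (shift_poly X)`_j.
Proof.
move=> kn /psd_relaxationP h kj.
have sk : real_split (shift_poly X)^`(k).
  by apply: (real_split_derivn (real_split_shift_poly X)); rewrite size_shift_poly.
have := real_split_coef_ge0 sk (j - k) h.
by rewrite coef_derivn subnKC // pmulrn_lge0 // ffact_gt0.
Qed.

Lemma coef_ge0_psd_relaxation k X : (k <= n)%N ->
  (forall j, (k <= j <= n)%N -> 0 <= (shift_poly X)`_j) -> psd_relaxation R n k X.
Proof.
move=> kn h; apply/psd_relaxationP => t; apply: coef_ge0_root_le0.
  move=> j; rewrite coef_derivn mulrn_wge0 //.
  have [jn|jn] := leqP (k + j) n; first by rewrite h ?leq_addr.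
  by rewrite nth_default // size_shift_poly.
by rewrite -size_poly_gt0 size_derivn size_shift_poly subn_gt0 ltnS.
Qed.

Definition touching k X Y :=
  forall s, s != 0 -> ~ psd_relaxation R n k (X + s *: Y).

Lemma touchingN k X Y : touching k X Y -> touching k X (- Y).
Proof.
by move=> h s s0; rewrite scalerN -scaleNr; apply: h; rewrite oppr_eq0.
Qed.

End Symmx.

(** At a zero of c, write c = 'X * q with q(0) = c'(0) > 0. *)
Lemma horner_ge0_right (R : rcfType) (c : {poly R}) :
  0 <= c.[0] -> (c.[0] == 0 -> 0 < c`_1) ->
  exists2 e, 0 < e & forall s, 0 < s < e -> 0 <= c.[s].
Proof.
have pos (q : {poly R}) : 0 < q.[0] ->
    exists2 e, 0 < e & forall s, 0 < s < e -> 0 <= q.[s].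
  move=> q0; have [e e0 h] := poly_cont 0 q q0.
  exists e => // s /andP[s0 se]; have := h s.
  rewrite subr0 gtr0_norm // => /(_ se); rewrite ltr_norml => /andP[+ _].
  by rewrite ltrBrDr addNr => /ltW.
move=> c0 c1; have [z0|nz0] := eqVneq c.[0] 0; last first.
  by apply: pos; rewrite lt_neqAle eq_sym nz0.
have /factor_theorem[q] : root c 0 by apply/rootP.
rewrite subr0 => cq; have [|e e0 h] := pos q.
  by move: (c1 (introT eqP z0)); rewrite cq coefMX /= horner_coef0.
exists e => // s sse; rewrite cq hornerM hornerX mulr_ge0 ?h //.
by case/andP: sse => /ltW.
Qed.

Lemma exists_common_right (R : realDomainType) (P : nat -> R -> Prop) N :
  (forall j, (j < N)%N -> exists2 e, 0 < e & forall s, 0 < s < e -> P j s) ->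
  exists2 e, 0 < e & forall s, 0 < s < e -> forall j, (j < N)%N -> P j s.
Proof.
elim: N => [|N IH] h; first by exists 1.
have [j jN|e e0 he] := IH; first by apply: h; apply: ltnW.
have [e' e0' he'] := h N (ltnSn N).
exists (Num.min e e'); first by rewrite lt_min e0.
move=> s; rewrite lt_min => /and3P[s0 se se'] j; rewrite ltnS leq_eqVlt.
by case/predU1P => [->|]; [apply: he'; rewrite s0|apply: he; rewrite s0].
Qed.

(** The form phi is the derivative at X of the coefficient of degree k of
    det(X + u I). The coefficients of degree > k are positive at X, hence along
    any line near X; if phi Y is nonzero, the coefficient of degree k increases
    when leaving X along Y or - Y, and one of these half-lines stays in the
    relaxation for a while. *)
Lemma touching_hyperplane (R : realType) n k (X : symmx R n) :
  (k.+1 < n)%N -> psd_relaxation R n k X -> ~ psd X ->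
  exists phi : symmx R n -> R,
    [/\ scalar phi, phi (symmx1 R n) != 0 &
        forall Y, touching k X Y -> phi Y = 0].
Proof.
move=> kn KX npsd; have /psd_relaxationP roots := KX.
pose p := shift_poly X; have sp : real_split p := real_split_shift_poly X.
have szp : size p = n.+1 by apply: size_shift_poly.
have kp : (k < size p)%N by rewrite szp; lia.
have sk := real_split_derivn sp kp.
have simple : (p^`(k)`_0 != 0) || (p^`(k)`_1 != 0).
  rewrite -negb_and; apply/negP => /andP[/eqP k0 /eqP k1]; apply: npsd.
  apply: psd_root_shift_poly; apply: (real_split_roots_le0_derivn sp kp) => //.
    by rewrite horner_coef0.
  by rewrite derivnS horner_coef0 coef_deriv k1 mul0rn.
have pos j : (k < j <= n)%N -> 0 < p`_j.
  move=> /andP[kj jn].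
  have := @real_split_coef_gt0 _ _ sk (j - k) roots simple.
  rewrite size_derivn szp coef_derivn subnKC ?(ltnW kj) //.
  rewrite pmulrn_lgt0 ?ffact_gt0 ?(ltnW kj) //.
  by apply; rewrite subn_gt0 kj /= ltn_sub2r // ltnS (leq_trans _ jn) // ltnW.
pose c (Y : symmx R n) j := (swapXY (pencil_poly (X : 'M[R]_n) Y))`_j.
have cE Y j s : (c Y j).[s] = (shift_poly (X + s *: Y : symmx R n))`_j.
  by rewrite horner_coef_pencil_poly.
have c0 Y j : (c Y j).[0] = p`_j by rewrite cE scale0r addr0.
pose phi Y := (c Y k)`_1.
have phi_lin : scalar phi.
  by move=> t Y Z; apply: coef1_pencil_poly_linear.
exists phi; split=> //.
  (* Along the identity, det(X + (u + s) I) is a translate of p, so the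
     coefficient of degree k is, up to k!, the k-th derivative of p at s. *)
  have E : horner (c (symmx1 R n) k *+ k`!) = horner p^`(k).
    apply/funext => s; rewrite hornerMn cE.
    rewrite -[symmx_val _]/((X : 'M[R]_n) + s *: 1%:M) scalemx1 shift_polyD.
    have := derivn_comp_affine p 1 s k; rewrite expr1n !scale1r.
    move=> /(congr1 (fun q => q.[0])); rewrite horner_coef0 coef_derivn addn0.
    by rewrite ffactnn => ->; rewrite horner_comp !hornerE.
  have := congr1 (fun f => f^`()%classic 0) E.
  rewrite -!derive.derivE !horner_coef0 !coef_deriv !mulr1n coefMn => Ephi.
  have : 0 < (phi (symmx1 R n)) *+ k`!.
    rewrite Ephi coef_derivn pmulrn_lgt0 ?ffact_gt0 ?leq_addr // pos //.
    by rewrite addn1 ltnSn ltnW.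
  by rewrite pmulrn_lgt0 ?fact_gt0 // => /gt_eqF ->.
have pos_not_touching Y : 0 < phi Y -> ~ touching k X Y.
  move=> phi0 tY.
  have [|e e0 h] := @exists_common_right R
    (fun j s => (k <= j)%N -> 0 <= (c Y j).[s]) n.+1.
    move=> j jn; have [kj|kj] := leqP k j; last by exists 1.
    have [||e e0 h] := @horner_ge0_right _ (c Y j).
    - by rewrite c0 (psd_relaxation_coef_ge0 _ KX) // -ltnS ltnW // ltnW.
    - rewrite c0; move: kj; rewrite leq_eqVlt => /predU1P[<- _ //|kj].
      by rewrite gt_eqF // pos // kj.
    - by exists e => // s /h.
  have e2 : 0 < e / 2 < e by apply/andP; split; lra.
  apply: (tY (e / 2)); first by rewrite gt_eqF //; case/andP: e2.
  apply: coef_ge0_psd_relaxation; first by lia.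
  by move=> j /andP[kj jn]; rewrite -cE; apply: h.
have phiN Y : phi (- Y) = - phi Y.
  have phi_0 : phi 0 = 0.
    have := phi_lin 1 0 0; rewrite scale1r addr0 => /eqP.
    by rewrite mul1r -subr_eq subrr eq_sym => /eqP.
  by have := phi_lin (-1) Y 0; rewrite scaleN1r addr0 phi_0 addr0 mulN1r.
move=> Y tY; apply/eqP; rewrite eq_le !leNgt; apply/andP; split; apply/negP.
  by move=> /pos_not_touching; apply.
rewrite -oppr_gt0 -phiN => /pos_not_touching; apply; exact: touchingN.
Qed.

(** * Diagonal matrices and the trace inequality *)

(** Newton's identity e_1^2 - p_2 = 2 e_2. *)
Lemma coef_prod_XsubC_size_sub2 (R : comNzRingType) (rs : seq R) :
  (1 < size rs)%N ->
  2 * (\prod_(r <- rs) ('X - r%:P))`_(size rs - 2) =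
  (\sum_(r <- rs) r) ^+ 2 - \sum_(r <- rs) r ^+ 2.
Proof.
elim: rs => // a [|b rs] IH _ //.
have c1 := @coefPn_prod_XsubC _ (b :: rs) isT.
have -> : (size [:: a, b & rs] - 2 = size rs)%N by rewrite /= subSS subn1.
rewrite /= in c1.
rewrite [\prod_(r <- a :: _) _]big_cons mulrBl coefB coefXM coefCM c1.
rewrite ![\sum_(r <- a :: _) _]big_cons mulrBr.
case: rs c1 IH => [|c rs] c1 IH; first by rewrite /= !big_seq1; ring.
have := IH isT; rewrite (_ : size [:: b, c & rs] - 2 = size rs)%N => [->|]; last first.
  by rewrite /= subSS subn1.
by ring.
Qed.

Section Diagonal.
Variables (R : realType) (n : nat).
Implicit Types (X Y : symmx R n) (d : 'rV[R]_n).

Fact diag_symmx_subproof d : diag_mx d \is symmetricmx.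
Proof. by rewrite symmetricmxE tr_diag_mx. Qed.

Definition diag_symmx d : symmx R n := SymMx (diag_symmx_subproof d).

Definition unit_symmx i : symmx R n := diag_symmx (delta_mx 0 i).

Lemma unit_symmxE i : unit_symmx i = delta_mx i i :> 'M[R]_n.
Proof.
rewrite /= diag_mx_sum_delta (bigD1 i) //= mxE !eqxx scale1r big1 ?addr0 //.
by move=> j ji; rewrite mxE eqxx (negbTE ji) scale0r.
Qed.

Lemma diag_symmxE d : diag_symmx d = \sum_i d 0 i *: unit_symmx i.
Proof.
apply: symmx_inj; rewrite /= diag_mx_sum_delta.
rewrite symmx_sum; apply: eq_bigr => i _.
by rewrite symmxZ unit_symmxE.
Qed.

Lemma mxtrace_sqr_sym X : \tr ((X : 'M[R]_n) *m X) = \sum_i \sum_j X i j ^+ 2.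
Proof.
apply: eq_bigr => i _; rewrite mxE; apply: eq_bigr => j _.
by rewrite -{2}(symmx_tr X) mxE expr2.
Qed.

(** For the eigenvalues of X, nonnegativity of e_2 reads p_2 <= p_1^2. *)
Lemma psd_relaxation_trace k X : (k + 2 <= n)%N -> psd_relaxation R n k X ->
  \sum_i \sum_j X i j ^+ 2 <= (\tr (X : 'M[R]_n)) ^+ 2.
Proof.
move=> kn KX; have := @psd_relaxation_coef_ge0 _ _ k X (n - 2) _ KX.
rewrite -mxtrace_sqr_sym.
have [Q [d [Q1 EX]]] := spectral_theorem (symmx_tr X).
rewrite EX shift_poly_spectral // => /(_ _ _).
have Q1' : Q^T *m Q = 1%:M by apply: mulmx1C.
have -> : Q^T *m diag_mx d *m Q *m (Q^T *m diag_mx d *m Q) =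
    Q^T *m (diag_mx d *m diag_mx d) *m Q.
  by rewrite !mulmxA -(mulmxA _ Q) Q1 mulmx1.
rewrite ![\tr (Q^T *m _ *m _)]mxtrace_mulC !mulmxA Q1 !mul1mx.
set rs := [seq _ | _ : 'I_n] => h.
have szrs : size rs = n by rewrite size_image card_ord.
have := @coef_prod_XsubC_size_sub2 _ rs; rewrite szrs => E.
have : 0 <= 2 * (\prod_(r <- rs) ('X - r%:P))`_(n - 2).
  by rewrite mulr_ge0 // h; lia.
rewrite E; last by lia.
rewrite /rs !big_image /= sumrN sqrrN subr_ge0.
rewrite mxtrace_diag; congr (_ <= _).
rewrite mulmx_diag mxtrace_diag; apply: eq_bigr => i _.
by rewrite sqrrN mxE expr2.
Qed.

End Diagonal.

(** * Touching directions at a rank-one matrix *)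

Section Touching.
Variables (R : realType) (n k : nat).
Implicit Types (X Y Z : symmx R n).

(** On the line E_ii + s Y the trace stays equal to the (i, i) entry, so by the
    trace inequality all the other entries vanish in the relaxation. *)
Lemma touching_unit_trace i Y a b : (k + 2 <= n)%N ->
  \tr (Y : 'M[R]_n) = Y i i -> (a != i) || (b != i) -> Y a b != 0 ->
  touching k (unit_symmx R i) Y.
Proof.
move=> kn trY abi Yab s s0 /(psd_relaxation_trace kn).
set X : symmx R n := _ + _.
have XE c d : X c d = (unit_symmx R i : 'M[R]_n) c d + s * Y c d.
  exact: symmx_lineE.
have XZ c d : (c != i) || (d != i) -> X c d = s * Y c d.
  rewrite XE unit_symmxE mxE -negb_and => /negbTE ->.
  by rewrite add0r.
have -> : \tr (X : 'M[R]_n) = X i i.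
  have trYi : \sum_(j | j != i) Y j j = 0.
    by apply: (addrI (Y i i)); rewrite addr0 -[RHS]trY [RHS](bigD1 i).
  rewrite /mxtrace (bigD1 i) //= -[RHS]addr0; congr (_ + _).
  have := congr1 ( *%R s) trYi; rewrite mulr0 mulr_sumr => E.
  rewrite -[RHS]E; apply: eq_bigr => j ji.
  by rewrite XZ // ji.
rewrite pair_big (bigD1 (i, i)) //= gerDl (bigD1 (a, b)) /=; last first.
  by rewrite xpair_eqE negb_and.
apply/negP; rewrite -ltNge ltr_wpDr //.
  by apply: sumr_ge0 => p _; rewrite sqr_ge0.
by rewrite XZ // lt_neqAle sqr_ge0 andbT eq_sym sqrf_eq0 mulf_neq0.
Qed.

Variables (i j1 j2 : 'I_n).
Hypotheses (ij1 : j1 != i) (ij2 : j2 != i) (j12 : j2 != j1).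

Let neqs := (negbTE ij1, negbTE ij2, negbTE j12, etrans (eq_sym i j1) (negbTE ij1),
  etrans (eq_sym i j2) (negbTE ij2), etrans (eq_sym j1 j2) (negbTE j12)).

(** Here e_3 (E_ii + s Y) = 1 * 2s * (- s) < 0. This direction leaves the
    hyperplane of those covered by [touching_unit_trace]. *)
Lemma touching_unit_diag : (k + 3 <= n)%N ->
  touching k (unit_symmx R i) (diag_symmx (2 *: delta_mx 0 j1 - delta_mx 0 j2)).
Proof.
move=> kn s s0 KX; have := psd_relaxation_coef_ge0 (j := n - 3) _ KX.
set d : 'rV[R]_n := delta_mx 0 i + s *: (2 *: delta_mx 0 j1 - delta_mx 0 j2).
have -> : (unit_symmx R i + s *: diag_symmx (2 *: delta_mx 0 j1 - delta_mx 0 j2)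
   : symmx R n) = diag_mx d :> 'M[R]_n.
  by rewrite /d linearD linearZ.
rewrite shift_poly_diag => /(_ _ _)-h.
have {h} : 0 <= (\prod_a ('X + (d 0 a)%:P))`_(n - 3) by apply: h; lia.
rewrite (bigD1 i) // (bigD1 j1) // (bigD1 j2) ?ij2 //=.
have -> : d 0 i = 1.
  by rewrite !mxE !eqxx !neqs /=; ring.
have -> : d 0 j1 = 2 * s.
  by rewrite !mxE !eqxx !neqs /=; ring.
have -> : d 0 j2 = - s.
  by rewrite !mxE !eqxx !neqs /=; ring.
rewrite (eq_bigr (fun=> 'X)) => [|a /andP[/andP[ai aj1] aj2]]; last first.
  rewrite !mxE eqxx /= (negbTE ai) (negbTE aj1) (negbTE aj2).
  by rewrite mulr0 subrr mulr0 addr0 addr0.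
rewrite prodr_const.
set m := #|_|; have -> : m = (n - 3)%N.
  have <- : #|~: [set i; j1; j2]| = (n - 3)%N.
    by rewrite cardsCs finset.setCK card_ord -finset.setUA cardsU1 cards2 !inE !neqs.
  by rewrite /m; apply: eq_card => a; rewrite !inE !negb_or.
rewrite !mulrA coefMXn ltnn subnn -horner_coef0 !hornerE.
apply/negP; rewrite -ltNge; have := s0; rewrite -sqrf_eq0 => s20.
have : 0 < s ^+ 2 by rewrite lt_neqAle eq_sym s20 sqr_ge0.
by rewrite expr2; nra.
Qed.

(** The matrices whose trace equals the (i, i) entry form a hyperplane, which
    the directions of [touching_unit_trace] span: multiples of E_ii are
    differences of two of them. The direction of [touching_unit_diag]
    completes it. *)
Lemma touching_unit_spans (phi : symmx R n -> R) : (k + 3 <= n)%N ->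
  scalar phi -> (forall Y, touching k (unit_symmx R i) Y -> phi Y = 0) ->
  forall Z, phi Z = 0.
Proof.
move=> kn phi_lin h.
have phiD Y Z : phi (Y + Z) = phi Y + phi Z.
  by rewrite -[Y in LHS]scale1r phi_lin mul1r.
have phi0 : phi 0 = 0 by apply: (addrI (phi 0)); rewrite -phiD !addr0.
have phiZ a Z : phi (a *: Z) = a * phi Z by rewrite -[_ *: _]addr0 phi_lin phi0 addr0.
(* B has trace 0 and D has trace 1, both with zero (i, i) entry. *)
pose B : symmx R n := diag_symmx (delta_mx 0 j1 - delta_mx 0 j2).
pose D : symmx R n := diag_symmx (2 *: delta_mx 0 j1 - delta_mx 0 j2).
have tr_delta (j : 'I_n) : \sum_(l < n) (delta_mx 0 j : 'rV[R]_n) 0 l = 1.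
  rewrite (bigD1 j) //= mxE !eqxx big1 ?addr0 // => l lj.
  by rewrite mxE (negbTE lj) andbF.
have trB : \tr (B : 'M[R]_n) = 0.
  rewrite mxtrace_diag; under eq_bigr do rewrite mxE [X in _ + X]mxE.
  by rewrite sumrB !tr_delta subrr.
have trD : \tr (D : 'M[R]_n) = 1.
  rewrite mxtrace_diag; under eq_bigr do rewrite mxE [X in _ + X]mxE [X in X - _]mxE.
  by rewrite sumrB -mulr_sumr !tr_delta; ring.
have Bii : B i i = 0.
  by rewrite !mxE !eqxx !neqs /= mulr1n subrr.
have Bj1 : B j1 j1 = 1.
  by rewrite !mxE !eqxx !neqs /= mulr1n subr0.
have Dii : D i i = 0.
  by rewrite !mxE !eqxx !neqs /= mulr0 mulr1n subrr.
have kn2 : (k + 2 <= n)%N by lia.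
have phiB : phi B = 0.
  apply/h/(touching_unit_trace (a := j1) (b := j1)) => //.
  - by rewrite trB Bii.
  - by rewrite ij1.
  - by rewrite Bj1 oner_eq0.
have phiD0 : phi D = 0 by apply/h/touching_unit_diag.
(* When W is a multiple of E_ii, it is W + B that is touching. *)
have phiW (W : symmx R n) : \tr (W : 'M[R]_n) = W i i -> phi W = 0.
  move=> trW; have [|W0] := boolP [exists p : 'I_n * 'I_n,
      ((p.1 != i) || (p.2 != i)) && (W p.1 p.2 != 0)].
    move=> /existsP[[a b] /= /andP[ab Wab]].
    exact/h/(touching_unit_trace (a := a) (b := b)).
  apply: (addIr (phi B)); rewrite -phiD phiB addr0.
  apply/h/(touching_unit_trace (a := j1) (b := j1)) => //.
  - rewrite -[symmx_val _]/((W : 'M[R]_n) + (B : 'M[R]_n)) mxtraceD trW trB.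
    by rewrite [RHS]mxE Bii.
  - by rewrite ij1.
  - rewrite -[symmx_val _]/((W : 'M[R]_n) + (B : 'M[R]_n)) mxE Bj1.
    suff -> : W j1 j1 = 0 by rewrite add0r oner_eq0.
    apply/eqP; apply: contraNT W0 => Wj; apply/existsP; exists (j1, j1).
    by rewrite /= ij1 Wj.
move=> Z; pose c := \tr (Z : 'M[R]_n) - Z i i.
have -> : Z = (Z + (- c) *: D) + c *: D by rewrite scaleNr subrK.
rewrite phiD phiZ phiD0 mulr0 addr0; apply: phiW.
rewrite symmx_lineE Dii -[symmx_val _]/((Z : 'M[R]_n) + (- c) *: (D : 'M[R]_n)).
by rewrite mxtraceD mxtraceZ trD /c; ring.
Qed.

End Touching.

(** * Automorphisms of the relaxation preserve positive semidefiniteness *)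

Section AutGroup.
Variables (R : realType) (V : lmodType R) (K : set V).
Implicit Types L : V -> V.

Lemma Aut_mem L : Aut K L -> forall x, K (L x) <-> K x.
Proof.
move=> [_ /bij_inj Linj KL] x; split=> [|Kx]; last by rewrite -KL; exists x.
by rewrite -{1}KL => -[y Ky /Linj <-].
Qed.

Lemma Aut_intro L L' : linear L -> cancel L L' -> cancel L' L ->
  (forall x, K x -> K (L x)) -> (forall x, K x -> K (L' x)) -> Aut K L.
Proof.
move=> Llin LK L'K KL KL'; split=> //; first by exists L'.
apply/seteqP; split=> [_ [x Kx <-]|x Kx]; first exact: KL.
by exists (L' x); [exact: KL'|exact: L'K].
Qed.

Lemma Aut_comp L1 L2 : Aut K L1 -> Aut K L2 -> Aut K (L1 \o L2).
Proof.
move=> [l1 b1 k1] [l2 b2 k2]; split; last by rewrite -image_comp k2 k1.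
  by move=> a x y; rewrite /= l2 l1.
exact: bij_comp.
Qed.

Lemma Aut_inverse L : Aut K L ->
  exists L', [/\ Aut K L', cancel L L' & cancel L' L].
Proof.
move=> AL; have [Llin [L' LK L'K] KL] := AL; exists L'; split=> //.
apply: (@Aut_intro _ L) => //.
- by move=> a x y; apply: (can_inj LK); rewrite Llin !L'K.
- by move=> x Kx; apply/(Aut_mem AL); rewrite L'K.
- by move=> x Kx; apply/(Aut_mem AL).
Qed.

End AutGroup.

Section LinearSum.
Variables (R : nzRingType) (V W : lmodType R) (L : V -> W).
Hypothesis Llin : linear L.

(** The elements of [Aut] are bare functions with a proof of linearity, to which
    the lemmas on bundled linear maps do not apply directly. *)
Lemma linear_propD x y : L (x + y) = L x + L y.
Proof. by rewrite -[x in LHS]scale1r Llin scale1r. Qed.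

Lemma linear_prop0 : L 0 = 0.
Proof. by apply: (addrI (L 0)); rewrite -linear_propD !addr0. Qed.

Lemma linear_propZ a x : L (a *: x) = a *: L x.
Proof. by rewrite -[_ *: _ in LHS]addr0 Llin linear_prop0 addr0. Qed.

Lemma linear_prop_sum (I : Type) (r : seq I) (P : pred I) (F : I -> V) :
  L (\sum_(i <- r | P i) F i) = \sum_(i <- r | P i) L (F i).
Proof. exact: (big_morph L linear_propD linear_prop0). Qed.

End LinearSum.

Section Congruence.
Variables (R : realType) (n : nat).
Implicit Types (X Y : symmx R n) (M Q : 'M[R]_n).

Lemma congr_mapE M X : congr_map M X = M *m X *m M^T :> 'M[R]_n.
Proof. by []. Qed.

Lemma congr_map_linear M : linear (congr_map M).
Proof.
move=> a X Y; apply: symmx_inj; rewrite congr_mapE.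
rewrite -[symmx_val (_ + congr_map M Y)]/(a *: (M *m X *m M^T) + M *m Y *m M^T).
rewrite -[symmx_val (_ + _)]/(a *: (X : 'M[R]_n) + Y).
by rewrite mulmxDr mulmxDl -scalemxAr -scalemxAl.
Qed.

Lemma congr_map_comp M1 M2 X :
  congr_map M1 (congr_map M2 X) = congr_map (M1 *m M2) X.
Proof. by apply: symmx_inj; rewrite !congr_mapE trmx_mul !mulmxA. Qed.

Lemma congr_map1 X : congr_map 1%:M X = X.
Proof. by apply: symmx_inj; rewrite congr_mapE trmx1 mul1mx mulmx1. Qed.

Lemma orthogonalmx_tr Q : orthogonalmx Q -> orthogonalmx Q^T.
Proof. by rewrite /orthogonalmx trmxK => /mulmx1C. Qed.

Lemma psd_relaxation_orthogonal k Q X : orthogonalmx Q ->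
  psd_relaxation R n k X -> psd_relaxation R n k (congr_map Q X).
Proof.
move=> /orthogonalmx_tr Q1 /psd_relaxationP h; apply/psd_relaxationP.
by rewrite congr_mapE -{1}(trmxK Q) shift_poly_orthogonal.
Qed.

Lemma Aut_orthogonal k Q : orthogonalmx Q ->
  Aut (psd_relaxation R n k) (congr_map Q).
Proof.
move=> Q1; have Q1' := orthogonalmx_tr Q1.
apply: (@Aut_intro _ _ _ _ (congr_map Q^T)).
- exact: congr_map_linear.
- by move=> X; rewrite congr_map_comp (mulmx1C Q1) congr_map1.
- by move=> X; rewrite congr_map_comp Q1 congr_map1.
- by move=> X; apply: psd_relaxation_orthogonal.
- by move=> X; apply: psd_relaxation_orthogonal.
Qed.

Lemma spectral_symmx X : exists Q d, orthogonalmx Q /\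
  X = congr_map Q (diag_symmx d).
Proof.
have [Q [d [Q1 EX]]] := spectral_theorem (symmx_tr X).
exists Q^T, d; split; first exact: orthogonalmx_tr.
by apply: symmx_inj; rewrite congr_mapE trmxK.
Qed.

Lemma psdD A B : psd A -> psd B -> psd (A + B : 'M[R]_n).
Proof. by move=> A0 B0 v; rewrite mulmxDr mulmxDl mxE addr_ge0. Qed.

Lemma psdZ a (A : 'M[R]_n) : 0 <= a -> psd A -> psd (a *: A).
Proof. by move=> a0 A0 v; rewrite -scalemxAr -scalemxAl mxE mulr_ge0. Qed.

Lemma psd_sum (I : Type) (r : seq I) (F : I -> 'M[R]_n) :
  (forall i, psd (F i)) -> psd (\sum_(i <- r) F i).
Proof.
move=> F0; elim/big_rec: _ => [v|i A _ A0]; last exact: psdD.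
by rewrite mulmx0 mul0mx mxE.
Qed.

Lemma psd_congr M (A : 'M[R]_n) : psd A -> psd (M *m A *m M^T).
Proof. by move=> A0 v; have := A0 (v *m M); rewrite trmx_mul !mulmxA. Qed.

Lemma psd_symmx_spectral X : psd X -> exists Q d,
  [/\ orthogonalmx Q, X = congr_map Q (diag_symmx d) & forall i, 0 <= d 0 i].
Proof.
have [Q [d [Q1 EX]]] := spectral_symmx X; exists Q, d; split=> // i.
have Q1' := orthogonalmx_tr Q1.
have := @psd_diag_ge0 _ _ Q^T d i Q1'; rewrite trmxK; apply.
by rewrite -[_ *m _]/(congr_map Q (diag_symmx d) : 'M[R]_n) -EX.
Qed.

Lemma psd_unit_symmx i : psd (unit_symmx R i : 'M[R]_n).
Proof.
move=> v; rewrite unit_symmxE -(mul_delta_mx (0 : 'I_1)) mulmxA -mulmxA.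
rewrite -[delta_mx 0 i *m _]trmxK trmx_mul trmxK trmx_delta.
by rewrite mulmx_trE big_ord1 -expr2 sqr_ge0.
Qed.

Lemma psd_relaxation_unit k i : (k <= n)%N ->
  psd_relaxation R n k (unit_symmx R i).
Proof.
move=> kn; apply: coef_ge0_psd_relaxation => // j _; rewrite shift_poly_diag.
elim/big_rec: _ j => [j|a p _ p0 j]; first by rewrite coef1 ler0n.
rewrite mulrDl coefD coefXM coefCM addr_ge0 //; first by case: eqP.
by rewrite mulr_ge0 // mxE; case: andP.
Qed.

End Congruence.

Section AutPsd.
Variables (R : realType) (n k : nat).
Hypotheses (k3 : (k + 3 <= n)%N).
Local Notation K := (psd_relaxation R n k).
Variable i : 'I_n.

Lemma exists_two_other : exists j1 j2 : 'I_n, [/\ j1 != i, j2 != i & j2 != j1].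
Proof.
have /card_gt1P[j1 [j2 []]] : (1 < #|predC1 i|)%N by rewrite cardC1 card_ord; lia.
by rewrite !inE => n1 n2 n3; exists j1, j2; split; rewrite // eq_sym.
Qed.

(** Otherwise the touching directions at the image of E_ii would lie in a
    hyperplane, and so would those at E_ii. *)
Lemma Aut_unit_psd L : Aut K L -> psd (L (unit_symmx R i)).
Proof.
move=> AL; apply: contrapT => npsd.
have [Llin _ _] := AL.
have [L' [_ LK L'K]] := Aut_inverse AL.
have KL : K (L (unit_symmx R i)).
  by apply/(Aut_mem AL); apply: psd_relaxation_unit; lia.
have [|phi [phi_lin phi1 phi0]] := touching_hyperplane _ KL npsd; first by lia.
have [j1 [j2 [n1 n2 n3]]] := exists_two_other.
case/eqP: phi1; rewrite -[symmx1 R n]L'K.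
apply: (touching_unit_spans n1 n2 n3 (phi := phi \o L) k3).
  by move=> a X Y /=; rewrite Llin phi_lin.
move=> Y tY; apply: phi0 => s s0 KY; apply: (tY s s0).
have E : L (unit_symmx R i + s *: Y) = L (unit_symmx R i) + s *: L Y.
  by rewrite (linear_propD Llin) (linear_propZ Llin).
rewrite -E in KY; exact: (proj1 (Aut_mem AL _) KY).
Qed.

End AutPsd.

(** By the spectral theorem X is a nonnegative combination of orthogonal
    congruences of the E_ii, and these congruences are automorphisms. *)
Lemma Aut_psd (R : realType) n k (L : symmx R n -> symmx R n) (X : symmx R n) :
  (k + 3 <= n)%N -> Aut (psd_relaxation R n k) L -> psd X -> psd (L X).
Proof.
move=> kn AL /psd_symmx_spectral[Q [d [Q1 -> d0]]].
have [Llin _ _] := AL.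
rewrite diag_symmxE (linear_prop_sum (congr_map_linear Q)) (linear_prop_sum Llin).
rewrite symmx_sum; apply: psd_sum => i.
rewrite (linear_propZ (congr_map_linear Q)) (linear_propZ Llin) symmxZ.
apply: psdZ => //; apply: (Aut_unit_psd kn i (L := L \o congr_map Q)).
by apply: Aut_comp => //; apply: Aut_orthogonal.
Qed.

(** * Entries of positive semidefinite matrices *)

Section PsdEntries.
Variables (R : realType) (n : nat).
Implicit Types (X Y : symmx R n) (u v : 'rV[R]_n).

Lemma psd_quad3 X i j l a b c : psd X ->
  0 <= a ^+ 2 * X i i + b ^+ 2 * X j j + c ^+ 2 * X l l +
       2 * a * b * X i j + 2 * a * c * X i l + 2 * b * c * X j l.
Proof.
pose e i : 'rV[R]_n := delta_mx 0 i.
move=> /(_ (a *: e i + b *: e j + c *: e l)).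
have qe p q : e p *m X *m (e q)^T = (X p q)%:M.
  rewrite -rowE trmx_delta -colE; apply/matrixP => x y.
  by rewrite !ord1 !mxE eqxx mulr1n.
have Xs p q : X q p = X p q by rewrite -{1}(symmx_tr X) mxE.
have -> : (a *: e i + b *: e j + c *: e l)^T =
    a *: (e i)^T + b *: (e j)^T + c *: (e l)^T by rewrite !linearD !linearZ.
rewrite !mulmxDl !mulmxDr -!scalemxAl -!scalemxAr.
rewrite !qe !mxE !mulr1n (Xs i j) (Xs i l) (Xs j l) => h.
by apply: le_trans h _; rewrite le_eqVlt; apply/orP; left; apply/eqP; ring.
Qed.

Lemma psd_quad2 X i j a b : psd X ->
  0 <= a ^+ 2 * X i i + b ^+ 2 * X j j + 2 * a * b * X i j.
Proof.
move=> /(psd_quad3 i j j a b 0); rewrite expr0n /= !mulr0 !mul0r !addr0.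
by [].
Qed.

Lemma psd_diag X i : psd X -> 0 <= X i i.
Proof.
move=> /(psd_quad2 i i 1 0).
by rewrite expr1n expr0n /= mulr0 !mul0r mul1r !addr0.
Qed.

Lemma psd_diag_eq0 X i j : psd X -> X i i = 0 -> X i j = 0.
Proof.
move=> X0 Xii; have [//|Xij] := eqVneq (X i j) 0.
(* The coefficient of e_i is chosen to give the quadratic form the value -1. *)
have := psd_quad2 i j (- (X j j + 1) / (2 * X i j)) 1 X0.
rewrite Xii mulr0 add0r expr1n mul1r mulr1.
have -> : 2 * (- (X j j + 1) / (2 * X i j)) * X i j = - (X j j + 1) by field.
by rewrite opprD addrA subrr add0r oppr_ge0 ler10.
Qed.

(** The matrix E_ii spans an extreme ray of the positive semidefinite cone. *)
Lemma psd_add_unit X Y i : psd X -> psd Y -> X + Y = unit_symmx R i ->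
  X = X i i *: unit_symmx R i.
Proof.
move=> X0 Y0 XY; apply: symmx_inj; rewrite symmxZ unit_symmxE.
have z p q : p != i -> X p q = 0.
  move=> pi; apply: psd_diag_eq0 => //.
  have := congr1 (fun Z : symmx R n => Z p p) XY.
  rewrite -[symmx_val (X + Y)]/((X : 'M[R]_n) + Y) unit_symmxE !mxE (negbTE pi) /=.
  by move/eqP; rewrite paddr_eq0 ?psd_diag // => /andP[/eqP].
apply/matrixP => p q; rewrite !mxE.
have [->|pi] := eqVneq p i; last by rewrite z // mulr0.
have [->|qi] := eqVneq q i; first by rewrite mulr1.
by rewrite -(symmx_tr X) mxE z // mulr0.
Qed.

Fact dyad_subproof u : u^T *m u \is symmetricmx.
Proof. by rewrite symmetricmxE trmx_mul trmxK. Qed.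

Definition dyad u : symmx R n := SymMx (dyad_subproof u).

Lemma dyadE u i j : dyad u i j = u 0 i * u 0 j.
Proof. by rewrite /= mxE big_ord1 mxE. Qed.

Lemma dyad_psd u : psd (dyad u).
Proof.
move=> v /=; rewrite mulmxA -mulmxA -[u *m _]trmxK trmx_mul trmxK.
by rewrite mulmx_trE big_ord1 -expr2 sqr_ge0.
Qed.

Lemma congr_map_dyad M u : congr_map M (dyad u) = dyad (u *m M^T).
Proof. by apply: symmx_inj; rewrite /= trmx_mul trmxK !mulmxA. Qed.

Lemma unit_symmx_dyad i : unit_symmx R i = dyad (delta_mx 0 i).
Proof.
by apply: symmx_inj; rewrite unit_symmxE /= trmx_delta mul_delta_mx.
Qed.

Lemma dyadZ a u : dyad (a *: u) = a ^+ 2 *: dyad u.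
Proof.
apply: symmx_inj; rewrite symmxZ /=.
have -> : (a *: u)^T = a *: u^T by rewrite linearZ.
by rewrite -scalemxAr -scalemxAl scalerA expr2.
Qed.

(** This is the polar form of [dyad] at two basis vectors. *)
Definition pair_symmx i j : symmx R n :=
  dyad (delta_mx 0 i + delta_mx 0 j) - unit_symmx R i - unit_symmx R j.

Lemma pair_symmxE i j :
  pair_symmx i j = delta_mx i j + delta_mx j i :> 'M[R]_n.
Proof.
rewrite -[symmx_val _]/((dyad _ : 'M[R]_n) - (unit_symmx R i : 'M[R]_n)
  - (unit_symmx R j : 'M[R]_n)) !unit_symmxE /=.
have -> : (delta_mx 0 i + delta_mx 0 j : 'rV[R]_n)^T = delta_mx i 0 + delta_mx j 0.
  by rewrite linearD /= !trmx_delta.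
rewrite mulmxDl !mulmxDr !mul_delta_mx.
by apply/matrixP => p q; rewrite !mxE; ring.
Qed.

Lemma pair_symmxC i j : pair_symmx i j = pair_symmx j i.
Proof. by apply: symmx_inj; rewrite !pair_symmxE addrC. Qed.

Lemma dyad_pair i j a :
  dyad (a *: delta_mx 0 i + delta_mx 0 j) =
  a ^+ 2 *: unit_symmx R i + a *: pair_symmx i j + unit_symmx R j.
Proof.
apply: symmx_inj; rewrite -[RHS]/(a ^+ 2 *: (unit_symmx R i : 'M[R]_n) +
  a *: (pair_symmx i j : 'M[R]_n) + (unit_symmx R j : 'M[R]_n)).
rewrite !unit_symmxE pair_symmxE /=.
have -> : (a *: delta_mx 0 i + delta_mx 0 j : 'rV[R]_n)^T =
    a *: delta_mx i 0 + delta_mx j 0 by rewrite linearD linearZ /= !trmx_delta.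
rewrite mulmxDl !mulmxDr -!scalemxAl -!scalemxAr !mul_delta_mx.
by apply/matrixP => p q; rewrite !mxE; ring.
Qed.

Lemma symmx_pairE X : X = \sum_i \sum_j (X i j / 2) *: pair_symmx i j.
Proof.
apply: symmx_inj; rewrite symmx_sum; under eq_bigr => i _.
  rewrite symmx_sum; under eq_bigr => j _ do rewrite symmxZ pair_symmxE scalerDr.
  rewrite big_split /=; over.
rewrite big_split /= [X in _ + X]exchange_big /=.
rewrite [LHS](_ : _ = 2^-1 *: ((X : 'M[R]_n) + (X : 'M[R]_n)^T)); last first.
  rewrite symmx_tr -mulr2n -[RHS]scalerMnr scalerMnl -mulr_natr mulVf ?pnatr_eq0 //.
  by rewrite scale1r.
rewrite scalerDr {1}(matrix_sum_delta X) [X in _ + _ *: X]matrix_sum_delta !scaler_sumr.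
congr (_ + _); apply: eq_bigr => i _; rewrite scaler_sumr; apply: eq_bigr => j _.
  by rewrite scalerA mulrC.
by rewrite mxE scalerA mulrC.
Qed.

End PsdEntries.

(** * Positive maps fixing the diagonal units *)

Section PsdPreservers.
Variables (R : realType) (n : nat).
Implicit Types (X Y : symmx R n) (L : symmx R n -> symmx R n).

Definition psd_preserving L := forall X, psd X -> psd (L X).

(** The matrices t^2 E_ii + t W + E_jj, with W the image of the (i, j) pair, are
    positive semidefinite for all t; this kills every entry of W except those
    at (i, j) and (j, i), and bounds the latter by 1. *)
Lemma psd_preserving_pair L i j : linear L -> psd_preserving L ->
  (forall l, L (unit_symmx R l) = unit_symmx R l) -> i != j ->
  exists2 c, L (pair_symmx R i j) = c *: pair_symmx R i j & `|c| <= 1.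
Proof.
move=> Llin Lpsd Lfix ij; set W := L (pair_symmx R i j).
have ji : j != i by rewrite eq_sym.
pose T t : symmx R n := t ^+ 2 *: unit_symmx R i + t *: W + unit_symmx R j.
have T0 t : psd (T t).
  have -> : T t = L (dyad (t *: delta_mx 0 i + delta_mx 0 j)).
    by rewrite dyad_pair !(linear_propD Llin) !(linear_propZ Llin) !Lfix.
  by apply: Lpsd; apply: dyad_psd.
have TE t p q : T t p q = t ^+ 2 * ((p == i) && (q == i))%:R + t * W p q +
    ((p == j) && (q == j))%:R.
  rewrite /T -[symmx_val _]/(t ^+ 2 *: (unit_symmx R i : 'M[R]_n) +
    t *: (W : 'M[R]_n) + (unit_symmx R j : 'M[R]_n)) !unit_symmxE.
  by rewrite !mxE.
(* The (i, i) entry of T t is t^2 + t W_ii, minimal at t = - W_ii / 2. *)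
have Wii : W i i = 0.
  have := psd_diag i (T0 (- (W i i / 2))); rewrite TE !eqxx (negbTE ij) /=.
  by move=> h; nra.
have Wjj : W j j = 0.
  have [//|Wj0] := eqVneq (W j j) 0.
  have := psd_diag j (T0 (- 2 / W j j)); rewrite TE !eqxx (negbTE ji) /=.
  by rewrite divfK //; lra.
have Woff l q : l != i -> l != j -> W l q = 0.
  move=> li lj; have Wll : W l l = 0.
    have := psd_diag l (T0 1); have := psd_diag l (T0 (- 1)).
    by rewrite !TE (negbTE li) (negbTE lj) /=; lra.
  have := @psd_diag_eq0 _ _ (T 1) l q (T0 1).
  by rewrite !TE (negbTE li) (negbTE lj) /= Wll !(mulr0, addr0, mul1r, add0r); apply.
have Ws p q : W p q = W q p by rewrite -{1}(symmx_tr W) mxE.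
exists (W i j).
  apply: symmx_inj; rewrite symmxZ pair_symmxE; apply/matrixP => p q; rewrite !mxE.
  have [->{p}|pi] := eqVneq p i.
    have [->{q}|qi] := eqVneq q i; first by rewrite Wii (negbTE ij) /=; ring.
    have [->|qj] := eqVneq q j; first by rewrite (negbTE ij) /=; ring.
    by rewrite (Ws i q) Woff // (negbTE ij) /=; ring.
  have [->{p pi}|pj] := eqVneq p j; last by rewrite Woff //=; ring.
  have [->{q}|qi] := eqVneq q i; first by rewrite /= Ws; ring.
  have [->|qj] := eqVneq q j; first by rewrite Wjj /=; ring.
  by rewrite (Ws j q) Woff //=; ring.
have := psd_quad2 i j 1 1 (T0 1); have := psd_quad2 i j 1 (- 1) (T0 1).
rewrite !TE !eqxx (negbTE ij) (negbTE ji) /= Wii Wjj => h1 h2.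
by rewrite ler_norml; apply/andP; split; lra.
Qed.

(** The map multiplies each entry (i, j) by a number c_ij, which has modulus
    at most 1 as does its inverse, so that c_ij^2 = 1. The matrix (c_ij) is the
    image of the all-ones matrix, hence positive semidefinite; testing it on the
    vector e_l - c_li e_i - c_lj e_j gives c_li c_lj c_ij = 1, and so c_ij is
    the product of the signs c_li and c_lj for any fixed l. *)
Lemma psd_preserving_fix_unit L L' :
  linear L -> linear L' -> cancel L L' -> psd_preserving L -> psd_preserving L' ->
  (forall l, L (unit_symmx R l) = unit_symmx R l) ->
  exists2 e : 'rV[R]_n, (forall i, e 0 i ^+ 2 = 1) &
    forall X, L X = congr_map (diag_mx e) X.
Proof.
move=> Llin L'lin LK Lpsd L'psd Lfix.
have L'fix l : L' (unit_symmx R l) = unit_symmx R l by rewrite -{1}Lfix LK.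
case: (pickP (fun _ : 'I_n => true)) => [i0 _|noi]; last first.
  exists 0 => [i|X]; first by have := noi i.
  by apply: symmx_inj; apply/matrixP => i; have := noi i.
pose J : symmx R n := dyad (const_mx 1).
pose C := L J.
have pair_eigen i j : exists2 c, L (pair_symmx R i j) = c *: pair_symmx R i j &
    c ^+ 2 = 1.
  have [->|ij] := eqVneq i j.
    exists 1; last by rewrite expr1n.
    rewrite scale1r; have -> : pair_symmx R j j = 2 *: unit_symmx R j.
      by apply: symmx_inj; rewrite symmxZ pair_symmxE unit_symmxE scaler_nat mulr2n.
    by rewrite (linear_propZ Llin) Lfix.
  have [c Ec c1] := psd_preserving_pair Llin Lpsd Lfix ij.
  have [c' Ec' c1'] := psd_preserving_pair L'lin L'psd L'fix ij.
  exists c => //; have cc : c * c' = 1.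
    have := congr1 L' Ec; rewrite LK (linear_propZ L'lin) Ec' scalerA.
    move=> /(congr1 (fun X : symmx R n => X i j)); rewrite symmxZ pair_symmxE.
    by rewrite !mxE !eqxx (negbTE ij) /= addr0 mulr1 => <-.
  have n1 : `|c| * `|c'| = 1 by rewrite -normrM cc normr1.
  have -> : c ^+ 2 = `|c| ^+ 2 by rewrite real_normK ?num_real.
  suff -> : `|c| = 1 by rewrite expr1n.
  by apply/le_anti; rewrite c1 /= -{1}n1 ler_piMr.
have [c Ec] : exists c : 'I_n -> 'I_n -> R, forall i j,
    L (pair_symmx R i j) = c i j *: pair_symmx R i j /\ c i j ^+ 2 = 1.
  have /choice[c hc] : forall p : 'I_n * 'I_n, exists c,
      L (pair_symmx R p.1 p.2) = c *: pair_symmx R p.1 p.2 /\ c ^+ 2 = 1.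
    by move=> [i j]; have [c] := pair_eigen i j; exists c.
  by exists (fun i j => c (i, j)) => i j; apply: (hc (i, j)).
have cs i j : c i j = c j i.
  have [Eij _] := Ec i j; have [Eji _] := Ec j i.
  move: Eij; rewrite pair_symmxC Eji => /(congr1 (fun X : symmx R n => X i j)).
  rewrite !symmxZ pair_symmxE !mxE !eqxx /= => /esym; apply: mulIf.
  by case: (_ && _); rewrite ?addr0 ?oner_eq0 // -mulr2n pnatr_eq0.
have LE X i j : L X i j = c i j * X i j.
  have cXs : \matrix_(i, j) (c i j * X i j) \is symmetricmx.
    apply: symmxP; apply/matrixP => p q; rewrite !mxE cs.
    by rewrite -{1}(symmx_tr X) mxE.
  suff -> : L X = SymMx cXs by rewrite mxE.
  rewrite [RHS]symmx_pairE {1}(symmx_pairE X) (linear_prop_sum Llin).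
  apply: eq_bigr => p _; rewrite (linear_prop_sum Llin); apply: eq_bigr => q _.
  rewrite (linear_propZ Llin) (Ec p q).1 scalerA; congr (_ *: _).
  by rewrite [in RHS]mxE; ring.
have CE i j : C i j = c i j by rewrite LE dyadE !mxE !mulr1.
have C0 : psd C by apply: Lpsd; apply: dyad_psd.
have cii i : c i i = 1.
  have := LE (unit_symmx R i) i i; rewrite Lfix unit_symmxE !mxE !eqxx mulr1.
  by move=> <-.
have cc i j : c i j = c i0 i * c i0 j.
  have := psd_quad3 i0 i j 1 (- c i0 i) (- c i0 j) C0.
  rewrite !CE !cii; have := (Ec i0 i).2; have := (Ec i0 j).2; have := (Ec i j).2.
  move: (c i0 i) (c i0 j) (c i j) => x y z hz hy hx h.
  have p1 : x * y * z = 1.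
    have : (x * y * z) ^+ 2 = 1 by rewrite !exprMn hx hy hz !mulr1.
    by move/eqP; rewrite sqrf_eq1 => /orP[] /eqP // E; exfalso; lra.
  have -> : z = (x * y * z) * (x * y) * z ^+ 2 + z * (1 - x ^+ 2 * y ^+ 2 * z ^+ 2).
    by ring.
  by rewrite hx hy hz p1; ring.
exists (\row_i c i0 i); first by move=> i; rewrite mxE (Ec i0 i).2.
move=> X; apply: symmx_inj; apply/matrixP => i j.
rewrite congr_mapE tr_diag_mx mul_diag_mx mul_mx_diag !mxE LE cc.
by ring.
Qed.

End PsdPreservers.

(** * Automorphisms of the positive semidefinite cone *)

Section PsdAutomorphisms.
Variables (R : realType) (n : nat).
Implicit Types (X Y : symmx R n) (L : symmx R n -> symmx R n).

Lemma congr_unit_symmx_dyad (Q : 'M[R]_n) i :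
  congr_map Q (unit_symmx R i) = dyad (delta_mx 0 i *m Q^T).
Proof. by rewrite unit_symmx_dyad congr_map_dyad. Qed.

Lemma psd_le_scalar X : exists c, psd (c *: symmx1 R n - X).
Proof.
have [Q [d [Q1 ->]]] := spectral_symmx X; exists (\sum_i `|d 0 i|).
set c := \sum_i _.
rewrite [symmx_val _](_ : _ = Q *m diag_mx (const_mx c - d) *m Q^T).
  rewrite -{1}[Q]trmxK; apply: psd_spectral => i; rewrite !mxE subr_ge0.
  rewrite /c (bigD1 i) //= (le_trans (ler_norm _)) // lerDl.
  by apply: sumr_ge0 => j _; apply: normr_ge0.
rewrite -[LHS]/(c *: 1%:M - Q *m diag_mx d *m Q^T) raddfB /= mulmxBr mulmxBl.
by rewrite diag_const_mx mul_mx_scalar -scalemxAl Q1.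
Qed.

Variables (L L' : symmx R n -> symmx R n).
Hypotheses (Llin : linear L) (L'lin : linear L').
Hypotheses (LK : cancel L L') (L'K : cancel L' L).
Hypotheses (Lpsd : psd_preserving L) (L'psd : psd_preserving L').

(** The image A of E_ii is a sum of rank-one terms. The inverse map writes E_ii
    as a sum of positive semidefinite matrices, all multiples of E_ii since this
    is an extreme ray; so every term of A is a multiple of A. *)
Lemma psd_preserving_unit_dyad i : exists u, L (unit_symmx R i) = dyad u.
Proof.
set A := L _.
have [Q [d [Q1 EA d0]]] := psd_symmx_spectral (Lpsd (@psd_unit_symmx R n i)).
pose P j := d 0 j *: congr_map Q (unit_symmx R j).
have AP : A = \sum_j P j.
  rewrite /A EA diag_symmxE (linear_prop_sum (congr_map_linear Q)).
  by apply: eq_bigr => j _; rewrite (linear_propZ (congr_map_linear Q)).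
have P0 j : psd (P j) by rewrite symmxZ; apply/psdZ/psd_congr/psd_unit_symmx.
have unit_neq0 (j : 'I_n) : unit_symmx R j != 0.
  apply/eqP => /(congr1 (fun X : symmx R n => X j j)).
  by rewrite unit_symmxE !mxE !eqxx => /eqP; rewrite oner_eq0.
have [j dj] : exists j, d 0 j != 0.
  apply: contrapT => nd; have := unit_neq0 i; rewrite -(LK (unit_symmx R i)).
  rewrite -/A AP big1 ?(linear_prop0 L'lin) ?eqxx // => j _.
  rewrite /P; have [->|dj] := eqVneq (d 0 j) 0; first by rewrite scale0r.
  by case: nd; exists j.
have Pj0 : P j != 0.
  rewrite /P; apply/eqP => /(congr1 (congr_map Q^T)).
  rewrite (linear_propZ (congr_map_linear _)) congr_map_comp (mulmx1C Q1).
  rewrite congr_map1 (linear_prop0 (congr_map_linear _)) => /eqP.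
  by rewrite scaler_eq0 (negbTE dj) (negbTE (unit_neq0 j)).
have := @psd_add_unit _ _ (L' (P j)) (L' (\sum_(l | l != j) P l)) i.
have -> : L' (P j) + L' (\sum_(l | l != j) P l) = unit_symmx R i.
  by rewrite -(linear_propD L'lin) -(LK (unit_symmx R i)) -/A AP [in RHS](bigD1 j).
set c := L' _ _ _ => Ec.
have {}Ec : P j = c *: A.
  apply: (can_inj L'K); rewrite [RHS](linear_propZ L'lin) /A LK; apply: Ec => //.
    exact: L'psd.
  apply: L'psd; rewrite symmx_sum.
  by elim/big_rec: _ => [v|l X _ X0]; [rewrite mulmx0 mul0mx mxE|apply: psdD].
have c0 : 0 <= c by apply/psd_diag/L'psd.
have c0' : c != 0 by apply: contra_neq Pj0 => c_eq0; rewrite Ec c_eq0 scale0r.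
exists (Num.sqrt (d 0 j / c) *: (delta_mx 0 j *m Q^T)).
rewrite dyadZ -congr_unit_symmx_dyad sqr_sqrtr ?divr_ge0 //.
by rewrite mulrC -scalerA -/(P j) Ec scalerA mulVf // scale1r.
Qed.

(** The congruence by M^T agrees with L on the E_ii. It is invertible: if
    v M^T = 0, then v L(1) v^T = 0, and as any matrix is bounded by a multiple
    of the identity, v L(Y) v^T <= 0 for all Y, in particular for the Y
    that L sends to the dyad of v. Then [psd_preserving_fix_unit] applies. *)
Lemma psd_preserving_congr : exists2 M, M \in unitmx & L = congr_map M.
Proof.
have /choice[u Lu] := psd_preserving_unit_dyad.
pose M : 'M[R]_n := \matrix_i u i.
have Mu i : L (unit_symmx R i) = congr_map M^T (unit_symmx R i).
  by rewrite congr_unit_symmx_dyad trmxK -rowE rowK Lu.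
have symmx1E : symmx1 R n = \sum_i unit_symmx R i.
  have -> : symmx1 R n = diag_symmx (const_mx 1).
    by apply: symmx_inj; rewrite /= diag_const_mx.
  by rewrite diag_symmxE; apply: eq_bigr => i _; rewrite mxE scale1r.
have L1 : L (symmx1 R n) = congr_map M^T (symmx1 R n).
  rewrite symmx1E (linear_prop_sum Llin) (linear_prop_sum (congr_map_linear _)).
  by apply: eq_bigr => i _; rewrite Mu.
have MU : M^T \in unitmx.
  rewrite unitmxE unitfE; apply/det0P => -[v v0 vM].
  have [c] := psd_le_scalar (L' (dyad v)).
  move=> /Lpsd/(_ v); rewrite (_ : L _ = c *: L (symmx1 R n) - dyad v); last first.
    by rewrite (linear_propD Llin) (linear_propZ Llin) -scaleN1r (linear_propZ Llin)
       L'K scaleN1r.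
  rewrite L1 -[symmx_val _]/(c *: (M^T *m 1%:M *m M^T^T) - v^T *m v).
  rewrite mulmxBr mulmxBl -scalemxAr -scalemxAl !mulmxA vM !mul0mx scaler0 sub0r mxE.
  rewrite [v *m v^T]mx11_scalar mul_scalar_mx -scalemxAl mxE oppr_ge0.
  by apply/negP; rewrite -ltNge mulr_gt0 // mulmx_tr_gt0.
pose N := invmx M^T.
have NM : N *m M^T = 1%:M by apply: mulVmx.
have MN : M^T *m N = 1%:M by apply: mulmxV.
have congr_psd P : psd_preserving (congr_map P) by move=> X; apply: psd_congr.
have [|||||l|e e1 eL] := @psd_preserving_fix_unit R n (congr_map N \o L)
    (L' \o congr_map M^T).
- by move=> a X Y /=; rewrite Llin congr_map_linear.
- by move=> a X Y /=; rewrite congr_map_linear L'lin.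
- by move=> X /=; rewrite congr_map_comp MN congr_map1 LK.
- by move=> X X0; apply/congr_psd/Lpsd.
- by move=> X X0; apply/L'psd/congr_psd.
- by rewrite /= Mu congr_map_comp NM congr_map1.
exists (M^T *m diag_mx e).
  rewrite unitmx_mul MU unitmxE det_diag unitfE; apply/prodf_neq0 => i _.
  by rewrite -sqrf_eq0 e1 oner_eq0.
apply/funext => X; rewrite -congr_map_comp -eL /= congr_map_comp MN.
by rewrite congr_map1.
Qed.

End PsdAutomorphisms.

(** * Congruences that preserve the relaxation *)

Section DiagonalTest.
Variables (R : realType) (n k : nat).
Implicit Types (S : {set 'I_n}) (i : 'I_n).

Definition test_row S i (y : 'I_n -> R) c : 'rV[R]_n :=
  \row_a (if a == i then c else if a \in S then y a else 0).

Lemma shift_poly_test S i y c : i \notin S ->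
  shift_poly (diag_mx (test_row S i y c)) =
  ('X + c%:P) * \prod_(a in S) ('X + (y a)%:P) * 'X^(n - #|S|.+1).
Proof.
move=> iS; rewrite shift_poly_diag (bigD1 i) //= mxE eqxx -mulrA; congr (_ * _).
rewrite (bigID (mem S)) /=; congr (_ * _).
  apply: eq_big => [a|a /andP[ai aS]]; last by rewrite mxE (negbTE ai) aS.
  by apply: andb_idl => aS; apply: contraNneq iS => <-.
rewrite (eq_bigr (fun=> 'X)) => [|a /andP[ai aS]]; last first.
  by rewrite mxE (negbTE ai) (negbTE aS) addr0.
rewrite prodr_const; congr ('X^ _).
have <- : #|~: (i |: S)| = (n - #|S|.+1)%N.
  by rewrite cardsCs finset.setCK card_ord cardsU1 iS add1n.
by apply: eq_card => a; rewrite !inE negb_or.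
Qed.

(** The relevant coefficients are those of positive degree in
    ('X - 1/m) ('X + 1)^m. With f = ('X + 1)^m, the identity m f = f' ('X + 1)
    gives f_(l+1) <= m f_l. *)
Lemma psd_relaxation_test S i : (0 < k)%N -> (#|S| + k = n)%N -> i \notin S ->
  psd_relaxation R n k (diag_symmx (test_row S i (fun=> 1) (- #|S|%:R^-1))).
Proof.
move=> k0 Sk iS; apply: coef_ge0_psd_relaxation => [|j /andP[kj _]]; first by lia.
rewrite shift_poly_test // prodr_const; set m := #|S| in Sk *.
have -> : (n - m.+1 = k.-1)%N by lia.
have [m0|m0] := posnP m.
  rewrite m0 invr0 oppr0 addr0 expr0 mulr1 -exprS coefXn ler0n //.
rewrite coefMXn ltnNge (leq_trans (leq_pred k) kj) /=.
case E: (j - k.-1)%N => [|l]; first by lia.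
pose f := ('X + 1%:P : {poly R}) ^+ m; rewrite -/f mulrDl coefD coefXM coefCM /=.
have fE : f *+ m = f^`() * ('X + 1%:P).
  rewrite /f deriv_exp derivD derivX derivC addr0 mul1r mulrnAl -exprSr.
  by rewrite prednK.
have f0 a : 0 <= f`_a.
  rewrite /f; elim: (m) a => [|p IH] a; first by rewrite expr0 coef1 ler0n.
  rewrite exprS mulrDl coefD coefXM coefCM mul1r addr_ge0 //.
  by case: eqP.
have := congr1 (fun p : {poly R} => p`_l) fE.
rewrite coefMn mulrDr coefD coefMX coefMC mulr1 !coef_deriv.
have m0' : 0 < (m%:R : R) by rewrite ltr0n.
move=> fl; have fl' : f`_l.+1 <= f`_l * m%:R.
  rewrite mulr_natr fl ler_wpDl //; last by rewrite mulrS lerDl mulrn_wge0.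
  by case: eqP => // _; rewrite mulrn_wge0.
by rewrite mulNr subr_ge0 mulrC ler_pdivrMr.
Qed.

Variable d : 'rV[R]_n.
Hypothesis d0 : forall i, 0 < d 0 i.
Hypothesis dK : forall x : 'rV[R]_n, psd_relaxation R n k (diag_symmx x) ->
  psd_relaxation R n k (diag_symmx (\row_i (d 0 i * x 0 i))).

(** The coefficient of degree k of the image of the test matrix is
    f(0) - (d_i / m) f'(0), where f is the product of the 'X + d_a for a in S,
    so that f'(0) / f(0) is the sum of the d_a^-1. *)
Lemma psd_relaxation_diag_le S i : (0 < k < n)%N -> (#|S| + k = n)%N ->
  i \notin S -> \sum_(a in S) d 0 i / d 0 a <= #|S|%:R.
Proof.
move=> /andP[k0 kn] Sk iS.
have := dK (psd_relaxation_test k0 Sk iS).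
set x := \row_i _; have -> : x = test_row S i (d 0) (- (d 0 i / #|S|%:R)).
  apply/rowP => a; rewrite !mxE; case: eqP => [->|_]; first by rewrite mulrN.
  by case: ifP; rewrite ?mulr1 ?mulr0.
move=> /psd_relaxation_coef_ge0-/(_ k (ltnW kn) (leqnn k)).
rewrite shift_poly_test // (_ : n - #|S|.+1 = k.-1)%N; last by lia.
have kk : (k - k.-1 = 1)%N by lia.
rewrite coefMXn ltnNge leq_pred /= kk mulrDl coefD coefXM coefCM /=.
rewrite -!horner_coef0.
rewrite -[X in - _ * X](_ : (\prod_(a in S) ('X + (d 0 a)%:P))^`().[0] = _); last first.
  by rewrite horner_coef0 coef_deriv.
rewrite [\prod_(a in S) _](_ : _ =
   \prod_(r <- [seq - d 0 a | a in S]) ('X - r%:P)); last first.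
  by rewrite big_image; apply: eq_bigr => a _; rewrite polyCN opprK.
rewrite horner_deriv_prod_XsubC ?horner_prod_XsubC; last first.
  apply/mapP => -[a _ /eqP]; rewrite eq_sym oppr_eq0.
  by rewrite gt_eqF.
rewrite !big_image /=; set P := \prod_(a in S) _; set s := \sum_(a in S) _.
have P0 : 0 < P by apply: prodr_gt0 => a _; rewrite sub0r opprK.
have m0 : 0 < (#|S|%:R : R) by rewrite ltr0n; lia.
rewrite mulNr mulrCA -{1}[P]mulr1 -mulrBr pmulr_rge0 // subr_ge0.
rewrite mulrAC ler_pdivrMr // mul1r; congr (_ <= _).
by rewrite /s mulr_sumr; apply: eq_bigr => a _; rewrite sub0r opprK.
Qed.

(** If d_i is maximal, the terms d_i / d_a are all >= 1 while their sum over S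
    is at most #|S|; hence all d_a with a in S equal d_i. The set S can be chosen
    to contain any given index other than i. *)
Lemma psd_relaxation_diag_const i j : (0 < k)%N -> (k + 2 <= n)%N ->
  d 0 i = d 0 j.
Proof.
move=> k0 kn.
have kk : (0 < k < n)%N by lia.
pose i0 := [arg max_(a > i) d 0 a]%O.
have i0max a : d 0 a <= d 0 i0.
  by rewrite /i0; case: arg_maxP => // b _; apply.
suff E a : d 0 a = d 0 i0 by rewrite !E.
have [->//|ai0] := eqVneq a i0.
have [S] : exists S : {set 'I_n}, [&& S \subset ~: [set i0; a] & #|S| == (n - k.+1)%N].
  have /card_gt0P[S] : (0 < #|[set S : {set 'I_n} | S \subset ~: [set i0; a] &
      #|S| == (n - k.+1)%N]|)%N.
    rewrite cards_draws bin_gt0 cardsCs finset.setCK card_ord cards2 eq_sym ai0.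
    by lia.
  by rewrite inE; exists S.
move=> /andP[/fintype.subsetP SS /eqP cS].
have aS : a \notin S by apply/negP => /SS; rewrite !inE eqxx orbT.
have iS : i0 \notin a |: S.
  rewrite !inE negb_or eq_sym ai0; apply/negP => /SS; by rewrite !inE eqxx.
have cS' : (#|a |: S| + k = n)%N by rewrite cardsU1 aS cS; lia.
have := psd_relaxation_diag_le kk cS' iS.
rewrite -sum1_card natr_sum -subr_ge0 -sumrB => h.
have ge1 b : 0 <= d 0 i0 / d 0 b - 1.
  by rewrite subr_ge0 ler_pdivlMr // mul1r.
have : \sum_(b in a |: S) (d 0 i0 / d 0 b - 1) == 0.
  rewrite eq_le sumr_ge0 ?andbT // -oppr_ge0 -sumrN.
  by move: h; congr (0 <= _); apply: eq_bigr => b _; rewrite opprB.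
rewrite psumr_eq0 // => /allP/(_ a (mem_index_enum a)).
rewrite !inE eqxx /= subr_eq0 => /eqP E.
by rewrite -[LHS]mul1r -E divfK // gt_eqF.
Qed.

End DiagonalTest.

Lemma shift_polyZ (R : fieldType) n (A : 'M[R]_n) a : a != 0 ->
  shift_poly (a *: A) = a ^+ n *: (shift_poly A \Po (a^-1 *: 'X + 0%:P)).
Proof.
move=> a0; rewrite /shift_poly /char_poly -mul_polyC polyC_exp.
rewrite -[_ \Po _]/(comp_poly _ _) -det_map_mx -detZ; congr (\det _).
apply/matrixP => i j; rewrite !mxE /= rmorphB /= !rmorphMn /=.
rewrite comp_polyX comp_polyC addr0 !polyCN polyCM !opprK mulrDr.
by rewrite mulrnAr -mul_polyC (mulrA a%:P) -(polyCM a a^-1) mulfV // mul1r.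
Qed.

Lemma psd_relaxationZ (R : realType) n k a (X : symmx R n) : 0 < a ->
  psd_relaxation R n k X -> psd_relaxation R n k (a *: X).
Proof.
move=> a0 /psd_relaxationP h; apply/psd_relaxationP => t.
have an0 : a != 0 by rewrite gt_eqF.
rewrite symmxZ shift_polyZ // derivnZ derivn_comp_affine.
rewrite !rootZ ?expf_neq0 ?invr_eq0 // root_comp hornerD hornerZ hornerX hornerC.
by rewrite addr0 => /h; rewrite pmulr_rle0 // invr_gt0.
Qed.

Section CongrRelaxation.
Variables (R : realType) (n k : nat).
Hypotheses (k0 : (0 < k)%N) (k2 : (k + 2 <= n)%N).

(** With M M^T = P^T diag(d) P and s = sqrt d, the matrix M is
    P^T diag(s) U with U orthogonal, so the congruence by diag(s) is again
    an automorphism. *)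
Lemma Aut_congr_orthogonal (M : 'M[R]_n) : M \in unitmx ->
  Aut (psd_relaxation R n k) (congr_map M) ->
  exists a Q, [/\ 0 < a, orthogonalmx Q & M = a *: Q].
Proof.
move=> Munit AM.
have MMT : (M *m M^T)^T = M *m M^T by rewrite trmx_mul trmxK.
have [P [d [P1 EM]]] := spectral_theorem MMT.
have P1' : P^T *m P = 1%:M by apply: mulmx1C.
have PMM : (P *m M) *m (P *m M)^T = diag_mx d.
  rewrite trmx_mul mulmxA -(mulmxA P) EM !mulmxA P1 mul1mx.
  by rewrite -mulmxA P1 mulmx1.
have d0 i : 0 < d 0 i.
  have -> : d 0 i = (row i (P *m M) *m (row i (P *m M))^T) 0 0.
    have diagE (N : 'M[R]_n) : (row i N *m (row i N)^T) 0 0 = (N *m N^T) i i.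
      by rewrite !mxE; apply: eq_bigr => j _; rewrite !mxE.
    by rewrite diagE PMM mxE eqxx mulr1n.
  apply: mulmx_tr_gt0; rewrite rowE mulmxA; apply/eqP.
  move=> /(congr1 (mulmx^~ (invmx M *m P^T))); rewrite mul0mx mulmxA mulmxK //.
  rewrite -mulmxA P1 mulmx1 => /rowP/(_ i); rewrite !mxE !eqxx => /eqP.
  by rewrite oner_eq0.
pose s : 'rV[R]_n := \row_i Num.sqrt (d 0 i).
have s0 i : 0 < s 0 i by rewrite mxE sqrtr_gt0.
have ss i : s 0 i ^+ 2 = d 0 i by rewrite mxE sqr_sqrtr // ltW.
pose t : 'rV[R]_n := \row_i (s 0 i)^-1.
have st : diag_mx s *m diag_mx t = 1%:M.
  rewrite mulmx_diag -diag_const_mx; congr diag_mx; apply/rowP => i.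
  by rewrite mxE [t 0 i]mxE [RHS]mxE mulfV // gt_eqF.
pose U := diag_mx t *m P *m M.
have ts : diag_mx t *m diag_mx d *m diag_mx t = 1%:M.
  have -> : diag_mx d = diag_mx s *m diag_mx s.
    by rewrite mulmx_diag; congr diag_mx; apply/rowP => i; rewrite mxE -expr2 ss.
  by rewrite !mulmxA (diag_mxC t s) st mul1mx st.
have U1 : orthogonalmx U.
  have -> : U = diag_mx t *m (P *m M) by rewrite /U mulmxA.
  rewrite /orthogonalmx [_^T]trmx_mul tr_diag_mx mulmxA.
  by rewrite -(mulmxA (diag_mx t)) PMM.
have ME : M = P^T *m diag_mx s *m U.
  by rewrite /U !mulmxA -(mulmxA P^T) st mulmx1 P1' mul1mx.
clearbody U.
have As : Aut (psd_relaxation R n k) (congr_map (diag_mx s)).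
  have : Aut (psd_relaxation R n k) (congr_map P \o congr_map M \o congr_map U^T).
    apply: Aut_comp; [apply: Aut_comp => //|]; apply: Aut_orthogonal => //.
    exact: orthogonalmx_tr.
  congr (Aut _ _); apply/funext => X /=.
  by rewrite !congr_map_comp ME !mulmxA P1 mul1mx -mulmxA U1 mulmx1.
have dK x : psd_relaxation R n k (diag_symmx x) ->
    psd_relaxation R n k (diag_symmx (\row_i (d 0 i * x 0 i))).
  have -> : diag_symmx (\row_i (d 0 i * x 0 i)) = congr_map (diag_mx s) (diag_symmx x).
    apply: symmx_inj; rewrite congr_mapE tr_diag_mx /= !mulmx_diag.
    congr diag_mx; apply/rowP => i; rewrite !mxE.
    by rewrite -{1}[d 0 i]sqr_sqrtr ?(ltW (d0 i)) //; ring.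
  by move=> Kx; exact: (proj2 (Aut_mem As _) Kx).
have i0 : 'I_n by case: (n) k2 => [|p]; [rewrite addn2 | exists 0%N].
have sE : diag_mx s = (s 0 i0)%:M.
  rewrite -diag_const_mx; congr diag_mx; apply/rowP => i; rewrite !mxE.
  by rewrite (psd_relaxation_diag_const d0 dK i i0).
exists (s 0 i0), (P^T *m U); split=> //.
  by rewrite /orthogonalmx trmx_mul mulmxA -(mulmxA P^T) U1 mulmx1 trmxK.
by rewrite {1}ME sE mul_mx_scalar scalemxAl.
Qed.

End CongrRelaxation.

Theorem theorem4p3 (R : realType) (n k : nat)
    (hn : (4 <= n)%N) (hk : (1 <= k <= n - 3)%N) :
  Aut (psd_relaxation R n k) =
  [set L : symmx R n -> symmx R n |
    exists (a : R) (Q : 'M[R]_n),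
      [/\ 0 < a, orthogonalmx Q & L = (fun X => a *: congr_map Q X)]].
Proof.
case/andP: hk => k0 kn; have k3 : (k + 3 <= n)%N by lia.
apply/seteqP; split=> L /=.
  move=> AL; have [L' [AL' LK L'K]] := Aut_inverse AL.
  have [Llin _ _] := AL; have [L'lin _ _] := AL'.
  have [M Munit LM] := psd_preserving_congr Llin L'lin LK L'K
    (fun X => Aut_psd k3 AL) (fun X => Aut_psd k3 AL').
  rewrite LM in AL; have k2 : (k + 2 <= n)%N by lia.
  have [a [Q [a0 Q1 MQ]]] := Aut_congr_orthogonal k0 k2 Munit AL.
  exists (a ^+ 2), Q; split=> //; first exact: exprn_gt0.
  rewrite LM MQ; apply/funext => X; apply: symmx_inj.
  rewrite symmxZ !congr_mapE linearZ /= -scalemxAr -!scalemxAl scalerA.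
  by rewrite expr2.
move=> [a [Q [a0 Q1 ->]]].
have Aa : Aut (psd_relaxation R n k) (fun X => a *: X).
  apply: (@Aut_intro _ _ _ _ (fun X => a^-1 *: X)).
  - by move=> b X Y; rewrite scalerDr !scalerA mulrC.
  - by move=> X; rewrite scalerA mulVf ?scale1r // gt_eqF.
  - by move=> X; rewrite scalerA mulfV ?scale1r // gt_eqF.
  - by move=> X; apply: psd_relaxationZ.
  - by move=> X; apply: psd_relaxationZ; rewrite invr_gt0.
exact: (Aut_comp Aa (Aut_orthogonal k Q1)).
Qed.
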